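(* Suppose that $\langle f_n\rangle$ is a sequence of real polynomials, that $f_n\to f$ weakly, where $f$ is a formal power series some coefficient of which is not $0$, and that the sequence $\langle N(f_n;\mathbb{C}\setminus\mathbb{R})\rangle$ is bounded. Then $f$ represents an entire function in $\mathcal{LP}^*$, and $f_n\to f$ strongly.
   Context: For an entire function $f$ not identically $0$ and $X\subset\mathbb{C}$, $N(f;X)$ denotes the number of zeros of $f$ lying in $X$, counted with multiplicity; if $f$ is identically $0$, set $N(f;X)=0$. An entire function (in particular a polynomial) $f$ is real if $f(\mathbb{R})\subset\mathbb{R}$. A sequence $\langle f_n\rangle$ of polynomials converges weakly if $\langle f_n^{(k)}(0)\rangle$ converges for every nonnegative integer $k$; its weak limit is then the formal power series $f$ whose $k$-th coefficient is $\frac{1}{k!}\lim_{n\to\infty}f_n^{(k)}(0)$ for every $k\ge 0$, and one writes $f_n\to f$ weakly. A sequence of entire functions converges strongly if it converges uniformly on compact subsets of $\mathbb{C}$. A formal power series represents an entire function if its radius of convergence is $\infty$; it is then identified with that entire function. The Laguerre-Pólya class $\mathcal{LP}$ is the collection of entire functions $f$ which can be represented in the form $$f(z)=cz^m e^{-\alpha z^2+\beta z}\prod_j\left(1-\frac{z}{a_j}\right)e^{z/a_j}\qquad(z\in\mathbb{C}),$$ where $c,\beta\in\mathbb{R}$, $m$ is a nonnegative integer, $\alpha\ge 0$, $a_1,a_2,\dots\in\mathbb{R}\setminus\{0\}$ (a finite, possibly empty, or infinite sequence), and $\sum_j a_j^{-2}<\infty$. The class $\mathcal{LP}^*$ consists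 of the real entire functions of the form $f=Pg$, where $P$ is a real polynomial and $g\in\mathcal{LP}$. *)

(* Defs.v *)
From HB Require Import structures.
From mathcomp Require Import all_boot all_order all_algebra.
From mathcomp Require Import all_classical all_reals all_analysis.
From mathcomp Require Import complex.

Set Implicit Arguments.
Unset Strict Implicit.
Unset Printing Implicit Defensive.

Import Order.TTheory GRing.Theory Num.Theory.
Import numFieldNormedType.Exports.
Import Normc.

Local Open Scope classical_set_scope.
Local Open Scope ring_scope.
Local Open Scope complex_scope.

(* R[i] already has a norm but is not recognized as a normed module over
   itself; this transfers the usual topology from R[i]^o. *)
#[non_forgetful_inheritance]
HB.instance Definition _ (R : realType) :=
  PseudoPointedMetric.copy R[i] R[i]^o.
#[non_forgetful_inheritance]
HB.instance Definition _ (R : realType) := NormedModule.copy R[i] R[i]^o.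

Definition real_line (R : realType) : set R[i] := range (fun x : R => x%:C).
Arguments real_line : clear implicits.

Definition real_fun (R : realType) (F : R[i] -> R[i]) : Prop :=
  F @` real_line R `<=` real_line R.

Definition real_poly (R : realType) (p : {poly R[i]}) : Prop :=
  real_fun (horner p).

(* derivable over the base field R[i] is complex differentiability *)
Definition entire (R : realType) (F : R[i] -> R[i]) : Prop :=
  forall z : R[i], derivable F z 1.

Definition num_zeros (R : realType) (p : {poly R[i]}) (X : set R[i]) : nat :=
  if p == 0 then 0%N
  else \big[addn/0%N]_(z \in X `&` [set z | root p z]) mup z p.

(* A formal power series is the sequence of its coefficients. *)
Definition weakly_converges (R : realType) (p : nat -> {poly R[i]})
    (f : nat -> R[i]) : Prop :=
  forall k : nat,
    cvgn (fun n => (p n)^`(k).[0]) /\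
    f k = (k`!%:R)^-1 * limn (fun n => (p n)^`(k).[0]).

Definition power_series (R : realType) (f : nat -> R[i]) (z : R[i]) :
    nat -> R[i] :=
  series (fun k => f k * z ^+ k).

Definition radius_of_convergence (R : realType) (f : nat -> R[i]) : \bar R :=
  ereal_sup [set (normc z)%:E | z in [set z | cvgn (power_series f z)]].

Definition power_series_sum (R : realType) (f : nat -> R[i]) (z : R[i]) :
    R[i] :=
  limn (power_series f z).

Definition strongly_converges (R : realType) (F : nat -> R[i] -> R[i])
    (G : R[i] -> R[i]) : Prop :=
  forall K : set R[i], compact K -> {uniform K, F @ \oo --> G}.

(* exp (x + iy) = exp x * (cos y + i sin y) *)
Definition expC (R : realType) (z : R[i]) : R[i] :=
  (expR (complex.Re z))%:C * (cos (complex.Im z) +i* sin (complex.Im z)).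

Definition weierstrass_factor (R : realType) (a : R) (z : R[i]) : R[i] :=
  (1 - z / a%:C) * expC (z / a%:C).

Definition canonical_product (R : realType) (G : R[i] -> R[i]) : Prop :=
  (exists s : seq R,
     (forall a, a \in s -> a != 0) /\
     forall z, G z = \prod_(a <- s) weierstrass_factor a z)
  \/
  (exists a : nat -> R,
     [/\ forall j, a j != 0,
         cvgn (series (fun j => (a j) ^- 2)) &
         forall z, (fun n => \prod_(j < n) weierstrass_factor (a j) z)
                     @ \oo --> G z]).

Definition laguerre_polya (R : realType) (F : R[i] -> R[i]) : Prop :=
  entire F /\
  exists (c alpha beta : R) (m : nat) (G : R[i] -> R[i]),
    [/\ 0 <= alpha, canonical_product G &
        forall z, F z =
          c%:C * z ^+ m * expC (- alpha%:C * z ^+ 2 + beta%:C * z) * G z].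

Definition laguerre_polya_star (R : realType) (F : R[i] -> R[i]) : Prop :=
  [/\ entire F, real_fun F &
      exists (p : {poly R[i]}) (G : R[i] -> R[i]),
        [/\ real_poly p, laguerre_polya G & forall z, F z = p.[z] * G z]].

(* Main.v *)
(* Each polynomial is split as q g, with q of bounded degree collecting the
   nonreal roots and g z = prod_j (1 - t_j z), t_j real. When the constant
   coefficient stays away from 0, Newton's identities bound the power sums of
   all reciprocal roots. By Dirichlet's pigeonhole argument some even power
   turns all nonreal reciprocal roots towards the right half-plane; as even
   power sums of real numbers are nonnegative, this bounds the nonreal
   reciprocal roots, hence q, sum_j t_j ^ 2 and sum_j t_j, hence the polynomial
   on every disc. By Rolle's theorem this applies to the m-th derivatives, where
   f m <> 0, so the sequence itself is bounded on discs: this gives strong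
   convergence to an entire function F.
   For the product form, the same bounds are used around a real point where F
   does not vanish and transported back to 0. Along an ultrafilter the t_j,
   sorted by decreasing modulus, and the bounded sums converge; the products of
   (1 - w) exp (w + w ^ 2 / 2) at w = t_j z pass to the limit because their
   tails are controlled by sum |t_j| ^ 3, and the defect of sum_j t_j ^ 2 in the
   limit is the Gaussian factor of the Laguerre-Polya form. *)
Require Import Defs.
From HB Require Import structures.
From mathcomp Require Import all_boot all_order all_algebra.
From mathcomp Require Import all_classical all_reals all_analysis.
From mathcomp Require Import complex polyrcf.
From mathcomp Require Import ring lra zify.

Set Implicit Arguments.
Unset Strict Implicit.
Unset Printing Implicit Defensive.

Import Order.TTheory GRing.Theory Num.Theory.
Import numFieldNormedType.Exports.
Import Normc.

Local Open Scope classical_set_scope.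
Local Open Scope ring_scope.
Local Open Scope complex_scope.

(** * The real-valued modulus on [R[i]], and Cauchy-type estimates for polynomials *)

Section ComplexModulus.
Variable R : realType.
Implicit Types (x y z : R[i]) (p : {poly R[i]}).

Lemma norm_normc z : `|z| = (normc z)%:C.
Proof. by case: z. Qed.

Lemma normc_ge0 z : 0 <= normc z.
Proof. by case: z => a b; exact: sqrtr_ge0. Qed.

Lemma normc_triangle x y : normc (x + y) <= normc x + normc y.
Proof. exact: (@le_normcD R x y). Qed.

Lemma normc_opp z : normc (- z) = normc z.
Proof. exact: (@normcN R z). Qed.

Lemma normc_sub_triangle x y : normc (x - y) <= normc x + normc y.
Proof. by rewrite (le_trans (normc_triangle _ _))// normc_opp. Qed.

Lemma normc_subC x y : normc (x - y) = normc (y - x).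
Proof. by rewrite -normc_opp opprB. Qed.

Lemma normc_sub_le x y : normc x <= normc y + normc (x - y).
Proof. by rewrite -{1}(subrKC y x) normc_triangle. Qed.

Lemma normc_real (a : R) : normc a%:C = `|a|.
Proof. by rewrite /normc /= expr0n /= addr0 sqrtr_sqr. Qed.

Lemma normc_nat n : normc (n%:R : R[i]) = n%:R.
Proof. by rewrite -(rmorph_nat (real_complex R)) normc_real normr_nat. Qed.

Lemma normc_0 : normc (0 : R[i]) = 0. Proof. exact: (@normc0 R). Qed.

Lemma normc_1 : normc (1 : R[i]) = 1. Proof. exact: (@normc1 R). Qed.

Lemma normc_eq0 z : (normc z == 0) = (z == 0).
Proof. by apply/eqP/eqP => [/eq0_normc//|->]; exact: normc_0. Qed.

Lemma normc_gt0 z : (0 < normc z) = (z != 0).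
Proof. by rewrite lt_neqAle normc_ge0 andbT eq_sym normc_eq0. Qed.

Lemma sqr_normc_ReIm z : normc z ^+ 2 = complex.Re z ^+ 2 + complex.Im z ^+ 2.
Proof. by case: z => a b; rewrite /normc sqr_sqrtr// addr_ge0 ?sqr_ge0. Qed.

Lemma Re_le_normc z : `|complex.Re z| <= normc z.
Proof.
rewrite -(@ler_pXn2r _ 2)// ?nnegrE ?normc_ge0//.
by rewrite sqr_normc_ReIm real_normK ?num_real// lerDl sqr_ge0.
Qed.

Lemma Im_le_normc z : `|complex.Im z| <= normc z.
Proof.
rewrite -(@ler_pXn2r _ 2)// ?nnegrE ?normc_ge0//.
by rewrite sqr_normc_ReIm real_normK ?num_real// lerDr sqr_ge0.
Qed.

Lemma normc_le_ReIm z : normc z <= `|complex.Re z| + `|complex.Im z|.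
Proof.
rewrite -(@ler_pXn2r _ 2)// ?nnegrE ?normc_ge0 ?addr_ge0//.
rewrite sqr_normc_ReIm sqrrD !real_normK ?num_real//.
by rewrite lerD2r lerDl mulrn_wge0 ?mulr_ge0.
Qed.

Lemma normc_exp z n : normc (z ^+ n) = normc z ^+ n.
Proof.
elim: n => [|n IH]; first by rewrite !expr0 normc_1.
by rewrite !exprS normcM IH.
Qed.

Lemma normc_prod (I : Type) (s : seq I) (P : pred I) (F : I -> R[i]) :
  normc (\prod_(i <- s | P i) F i) = \prod_(i <- s | P i) normc (F i).
Proof.
elim/big_rec2: _ => [|i a b _ <-]; first exact: normc_1.
by rewrite normcM.
Qed.

Lemma normc_sum (I : Type) (s : seq I) (P : pred I) (F : I -> R[i]) :
  normc (\sum_(i <- s | P i) F i) <= \sum_(i <- s | P i) normc (F i).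
Proof.
elim/big_rec2: _ => [|i a b _ ba]; first by rewrite normc_0.
by rewrite (le_trans (normc_triangle _ _))// lerD2l.
Qed.

Lemma normc_horner_le p z (r : R) :
  normc z <= r -> normc p.[z] <= \sum_(k < size p) normc p`_k * r ^+ k.
Proof.
move=> zr; rewrite horner_coef (le_trans (normc_sum _ _ _))// ler_sum// => k _.
rewrite normcM normc_exp ler_wpM2l ?normc_ge0//.
by rewrite lerXn2r// nnegrE ?(le_trans (normc_ge0 z)) ?normc_ge0.
Qed.

(* Averaging p over z and -z halves the degree without increasing the bound. *)
Lemma circle_bound_at_0 p (B r : R) :
  (forall z, normc z = r -> normc p.[z] <= B) -> 0 <= r -> normc p.[0] <= B.
Proof.
have [n] := ubnP (size p); elim: n => // n IH in p r *.
rewrite ltnS => pn pB r0.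
have [p1|p1] := leqP (size p) 1.
  by rewrite (size1_polyC p1) hornerC -(hornerC p`_0 r%:C) -(size1_polyC p1);
    apply: pB; rewrite normc_real ger0_norm.
have p0E : p.[0] = (even_poly p).[0].
  by rewrite -{1}(poly_even_odd p) !hornerE !horner_comp !hornerE expr0n.
rewrite p0E; apply: (IH (even_poly p) (r ^+ 2)); last exact: sqr_ge0.
  rewrite (leq_trans _ pn)// (leq_ltn_trans (size_even_poly _))//.
  by rewrite uphalf_half; case: (size p) p1 => [|[|m]]//= _; lia.
move=> w wr; set z := sqrtc w.
have zz : z ^+ 2 = w by exact: sqr_sqrtc.
have zr : normc z = r.
  apply/eqP; rewrite -(@eqrXn2 _ 2) ?normc_ge0//.
  by rewrite -normc_exp zz wr.
have -> : (even_poly p).[w] = (2^-1)%:C * (p.[z] + p.[- z]).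
  rewrite -{2 3}(poly_even_odd p) !(hornerE, horner_comp) /= sqrrN.
  rewrite zz mulrN addrAC addrK -mulr2n -(mulr_natl (even_poly p).[w]) mulrA.
  by rewrite -(rmorph_nat (real_complex R)) -rmorphM /= mulVf ?mul1r ?pnatr_eq0.
rewrite normcM normc_real ger0_norm ?invr_ge0// ler_pdivrMl// mulr2n mulrDl mul1r.
by rewrite (le_trans (normc_triangle _ _))// lerD// pB// normc_opp.
Qed.

(** Subtracting the constant coefficient and dividing by [z] shifts the coefficients by one and
    turns the bound [B] on the circle into [2 * B / r]. Iterating gives a Cauchy estimate without
    integration, at the price of a factor 2 per coefficient. *)
Lemma circle_bound_coef p (B r : R) k : 0 < r ->
  (forall z, normc z = r -> normc p.[z] <= B) -> normc p`_k * r ^+ k <= 2 ^+ k * B.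
Proof.
move=> r0; elim: k => [|k IH] in p B *=> pB.
  by rewrite !expr0 mulr1 mul1r -horner_coef0 (circle_bound_at_0 pB)// ltW.
pose q := drop_poly 1 p.
have qB z : normc z = r -> normc q.[z] <= 2 * B / r.
  move=> zr; have z0 : z != 0 by rewrite -normc_gt0 zr.
  have pE : p.[z] = p.[0] + q.[z] * z.
    rewrite -{1}(poly_take_drop 1 p) !hornerE; congr (_ + _).
    by rewrite (size1_polyC (size_take_poly 1 p)) hornerC coef_take_poly horner_coef0.
  have -> : q.[z] = (p.[z] - p.[0]) / z by rewrite pE addrC addKr mulfK.
  rewrite normcM normcV zr ler_wpM2r ?invr_ge0 ?(ltW r0)//.
  rewrite (le_trans (normc_sub_triangle _ _))// mulrDl mul1r lerD ?(pB z)//.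
  by rewrite (circle_bound_at_0 pB)// ltW.
have := IH q (2 * B / r) qB; rewrite coef_drop_poly addn1 => h.
rewrite exprSr mulrA -ler_pdivlMr// (le_trans h)//.
by rewrite exprSr !mulrA.
Qed.

End ComplexModulus.

(** * Polynomials written through their reciprocal roots, and Newton's identities *)

Section ReciprocalRoots.
Variable F : comNzRingType.
Implicit Types (s : seq F).

Definition recip_prod s : {poly F} := \prod_(x <- s) (1 - x *: 'X).

Definition power_sum k s : F := \sum_(x <- s) x ^+ k.

Lemma recip_prod_cat s1 s2 :
  recip_prod (s1 ++ s2) = recip_prod s1 * recip_prod s2.
Proof. by rewrite /recip_prod big_cat. Qed.

Lemma recip_prod_cons x s :
  recip_prod (x :: s) = (1 - x *: 'X) * recip_prod s.
Proof. by rewrite /recip_prod big_cons. Qed.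

Lemma horner_recip_prod s z :
  (recip_prod s).[z] = \prod_(x <- s) (1 - x * z).
Proof. by rewrite horner_prod; apply: eq_bigr => x _; rewrite !hornerE. Qed.

Lemma geometric_poly (x : F) n :
  (1 - x *: 'X) * (\sum_(1 <= j < n.+1) x ^+ j *: 'X^j) =
  x *: 'X - x ^+ n.+1 *: 'X^(n.+1).
Proof.
elim: n => [|n IH]; first by rewrite big_nil mulr0 expr1 expr1 subrr.
rewrite big_nat_recr//= mulrDr IH mulrBl mul1r -scalerAl -scalerAr scalerA.
by rewrite -exprS -(exprS 'X) addrA subrK.
Qed.

(* The power sums are, up to sign, the coefficients of X P'/P. *)
Lemma newton_dvd s n : exists r : {poly F},
  'X * (recip_prod s)^`() +
  recip_prod s * (\sum_(1 <= j < n.+1) power_sum j s *: 'X^j) = r * 'X^(n.+1).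
Proof.
elim: s => [|x s [r IH]].
  exists 0; rewrite /recip_prod big_nil derivC mulr0 mul1r add0r mul0r.
  by rewrite big1// => j _; rewrite /power_sum big_nil scale0r.
exists ((1 - x *: 'X) * r - x ^+ n.+1 *: recip_prod s).
rewrite recip_prod_cons derivM derivB derivC derivZ derivX sub0r.
under eq_bigr do rewrite /power_sum big_cons scalerDl.
rewrite big_split/=; set G := \sum_(1 <= j < n.+1) x ^+ j *: _.
set H := \sum_(1 <= j < n.+1) _.
have -> : 'X * (- (x *: 1) * recip_prod s + (1 - x *: 'X) * (recip_prod s)^`()) +
  (1 - x *: 'X) * recip_prod s * (G + H) =
  (1 - x *: 'X) * ('X * (recip_prod s)^`() + recip_prod s * H) +
  recip_prod s * ((1 - x *: 'X) * G - 'X * (x *: 1)) by ring.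
by rewrite IH geometric_poly -!mul_polyC; ring.
Qed.

(** In [newton_dvd] with [n = k] the right-hand side is a multiple of ['X^(k.+1)], so its
    coefficient of index [k] vanishes. The scalar [a] covers constant coefficients other than 1. *)
Lemma newton_identity (a : F) s k (P := a *: recip_prod s) :
  P`_k *+ k + \sum_(1 <= j < k.+1) power_sum j s * P`_(k - j) = 0.
Proof.
have [r /(congr1 (fun p : {poly F} => a * p`_k))] := newton_dvd s k.
rewrite coefMXn ltnSn mulr0 => h; rewrite -[RHS]h {h}.
rewrite coefD mulrDr; congr (_ + _).
  rewrite /P coefZ; case: k => [|k]; first by rewrite coefXM eqxx mulr0.
  by rewrite coefXM/= coef_deriv -mulrnAr.
rewrite mulr_sumr coef_sum mulr_sumr; apply: eq_big_nat => j /andP[_ jk].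
rewrite -scalerAr [in RHS]coefZ coefMXn ltnNge -ltnS jk/= /P coefZ.
exact: mulrCA.
Qed.

End ReciprocalRoots.

Lemma recip_prod_XsubC (F : fieldType) (s : seq F) : 0 \notin s ->
  \prod_(x <- s) ('X - x%:P) =
  (\prod_(x <- s) - x) *: recip_prod (map GRing.inv s).
Proof.
elim: s => [|x s IH]; first by rewrite /recip_prod/= !big_nil scale1r.
rewrite inE negb_or eq_sym => /andP[x0 s0] /=.
rewrite !big_cons IH// recip_prod_cons -scalerAr [in RHS](mulrC (- x)) -scalerA.
congr (_ *: _); rewrite scalerAl; congr (_ * _).
by rewrite scalerBr scalerA mulNr mulfV// scaleN1r opprK addrC scaleNr alg_polyC.
Qed.

Lemma recip_prod_closed (F : closedFieldType) (q : {poly F}) : q`_0 != 0 ->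
  exists w, q = q`_0 *: recip_prod w /\ (size w < size q)%N.
Proof.
move=> q0; have [s qE] := closed_field_poly_normal q.
have qn0 : q != 0 by apply: contraNneq q0 => ->; rewrite coef0.
have s0 : 0 \notin s.
  apply: contra q0 => s0; rewrite -horner_coef0 qE hornerZ horner_prod.
  by rewrite (big_rem 0)//= hornerXsubC subrr mul0r mulr0.
have sq : size q = (size s).+1.
  by rewrite qE size_scale ?lead_coef_eq0// size_prod_XsubC.
exists (map GRing.inv s); rewrite size_map sq; split => //.
have qE' : q = (lead_coef q * \prod_(x <- s) - x) *: recip_prod (map GRing.inv s).
  by rewrite {1}qE recip_prod_XsubC// scalerA.
rewrite {1}qE'; congr (_ *: _).
rewrite -horner_coef0 [in RHS]qE' hornerZ horner_recip_prod [X in _ = _ * X]big1 ?mulr1// => x _.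
by rewrite mulr0 subr0.
Qed.

(** * Uniform bounds on real and nonreal reciprocal roots *)

Section APriori.
Variable R : realType.
Local Notation toC := (real_complex R).
Implicit Types (P Q : {poly R}) (s t : seq R) (w : seq R[i]).

(* Pigeonhole on the cells of a grid of mesh 1/4 containing the points
   u ^+ 2 k, u in w. *)
Lemma simultaneous_even_power M : exists K, forall w, (size w <= M)%N ->
  exists2 k, (0 < k <= K)%N &
    forall x, x \in w -> normc x ^+ k.*2 <= 2 * complex.Re (x ^+ k.*2).
Proof.
(* Coordinates in [-1, 1] are mapped to [0, 8] by adding 1 and multiplying by 4, so truncation takes
   the nine values 0 to 8. Below there is one exponent more than there are elements of [T]. *)
pose T : finType := {ffun 'I_M -> 'I_9 * 'I_9}.
exists #|T| => w wM.
pose u i := w`_i / (normc w`_i)%:C.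
have u1 i : w`_i != 0 -> normc (u i) = 1.
  move=> wi; rewrite normcM normcV normc_real ger0_norm ?normc_ge0//.
  by rewrite mulfV ?normc_eq0.
pose cell (a : R) : 'I_9 := inord (Num.truncn ((a + 1) * 4)).
have cellP a b : `|a| <= 1 -> `|b| <= 1 -> cell a = cell b -> `|a - b| <= 4^-1.
  have h (c : R) : `|c| <= 1 -> (Num.truncn ((c + 1) * 4))%:R <= (c + 1) * 4 <
      (Num.truncn ((c + 1) * 4)).+1%:R /\ (Num.truncn ((c + 1) * 4) < 9)%N.
    rewrite ler_norml => /andP[c1 c2].
    have c0 : 0 <= (c + 1) * 4 by lra.
    have /andP[h1 h2] := truncn_itv c0; split; first by rewrite h1 h2.
    rewrite -(ltr_nat R); apply: le_lt_trans h1 _.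
    by lra.
  move=> /h[/andP[a1 a2] a3] /h[/andP[b1 b2] b3] /(congr1 (@nat_of_ord _)).
  rewrite !inordK// => ab; move: a1 a2 b1 b2; rewrite ab.
  set m := Num.truncn _; rewrite -[m.+1%:R]natr1 => a1 a2 b1 b2.
  by rewrite ler_norml; apply/andP; split; lra.
pose phi (k : 'I_#|T|.+1) : T :=
  [ffun i : 'I_M => (cell (complex.Re (u i ^+ k.*2)), cell (complex.Im (u i ^+ k.*2)))].
have /injectivePn[a [b ab phiab]] : ~~ injectiveb phi.
  by apply/negP => /injectiveP /leq_card; rewrite card_ord ltnn.
wlog lab : a b ab phiab / (a < b)%N.
  move=> H; have := ab; rewrite -val_eqE neq_ltn => /orP[|] h; first exact: (H a b).
  by apply: (H b a) => //; rewrite eq_sym.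
exists (b - a)%N; first by rewrite subn_gt0 lab (leq_trans (leq_subr _ _))// -ltnS.
move=> x /(nthP 0)[i iw <-]; have iM := leq_trans iw wM.
have [->|wi] := eqVneq w`_i 0.
  by rewrite normc_0 !expr0n double_eq0 subn_eq0 leqNgt lab/= mulr0.
have uk k : normc (u i ^+ k) = 1 by rewrite normc_exp u1// expr1n.
have close : normc (u i ^+ a.*2 - u i ^+ b.*2) <= 2^-1.
  have /= := congr1 (fun f : T => f (Ordinal iM)) phiab.
  rewrite !ffunE /= => -[/cellP h1 /cellP h2].
  rewrite (le_trans (normc_le_ReIm _))//.
  have := h1 _ _; have := h2 _ _.
  rewrite !(le_trans (Re_le_normc _)) ?uk// !(le_trans (Im_le_normc _)) ?uk//.
  move=> /(_ isT isT) {}h2 /(_ isT isT) {}h1.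
  move: h1 h2; case: (u i ^+ a.*2) => a1 a2; case: (u i ^+ b.*2) => b1 b2 /= h1 h2.
  by rewrite (le_trans (lerD h1 h2))//; lra.
set k := (b - a)%N in close *.
have bE : b.*2 = (a.*2 + k.*2)%N by rewrite -doubleD subnKC// ltnW.
(* Factoring out [u i ^+ a.*2], of modulus 1, shows that [u i ^+ k.*2] is within 1/2 of 1; hence its
   real part is at least 1/2. *)
move: close; rewrite bE exprD -{1}(mulr1 (u i ^+ a.*2)) -mulrBr normcM uk mul1r => close.
have wE : w`_i ^+ k.*2 = (normc w`_i ^+ k.*2)%:C * u i ^+ k.*2.
  rewrite exprMn mulrCA -[LHS]mulr1; congr (_ * _).
  rewrite rmorphXn /= -exprMn mulfV ?expr1n//.
  by rewrite (inj_eq (@complexI R)) normc_eq0.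
have Re2 : 2^-1 <= complex.Re (u i ^+ k.*2).
  have := le_trans (Re_le_normc _) close; case: (u i ^+ k.*2) => c d /=.
  by rewrite ler_norml => /andP[]; lra.
have n0 : 0 <= normc w`_i ^+ k.*2 by rewrite exprn_ge0// normc_ge0.
rewrite wE; move: n0 Re2; case: (u i ^+ k.*2) => c d /= n0 c2.
by rewrite mul0r subr0; nra.
Qed.

(** Newton's identity expresses [a] times the next power sum through the coefficients and the
    earlier power sums; dividing by [normc a], at least [c], gives a bound that does not depend on
    the number of reciprocal roots. *)
Lemma power_sum_bound (B : nat -> R) (c : R) n :
  (forall k, 0 <= B k) -> 0 < c -> exists2 b, 0 <= b &
  forall (a : R[i]) w, (forall k, normc (a *: recip_prod w)`_k <= B k) ->
    c <= normc a -> forall k, (0 < k <= n)%N -> normc (power_sum k w) <= b.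
Proof.
move=> B0 c0; elim: n => [|n [b b0 IH]].
  by exists 0 => // a w _ _ [|k].
pose b' := (B n.+1 *+ n.+1 + \sum_(1 <= j < n.+1) b * B (n.+1 - j)%N) / c.
have b'0 : 0 <= b'.
  rewrite divr_ge0 ?(ltW c0)// addr_ge0 ?mulrn_wge0 ?B0//.
  by rewrite sumr_ge0// => j _; rewrite mulr_ge0.
exists (b + b'); first exact: addr_ge0.
move=> a w aB ca k /andP[k0]; rewrite leq_eqVlt => /orP[/eqP->|]; last first.
  rewrite ltnS => kn; rewrite (le_trans (IH a w aB ca k _)) ?k0// lerDl//.
rewrite ler_wpDl//.
have := newton_identity a w n.+1; cbv zeta; rewrite big_nat_recr//= subnn.
have -> : (a *: recip_prod w)`_0 = a.
  by rewrite -horner_coef0 hornerZ horner_recip_prod big1 ?mulr1// => x _;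
    rewrite mulr0 subr0.
rewrite addrA => /eqP; rewrite addr_eq0 => /eqP /(congr1 (@normc R)).
rewrite normc_opp normcM => h.
rewrite /b' ler_pdivlMr//.
rewrite (le_trans (ler_wpM2l (normc_ge0 _) ca))// -h.
rewrite (le_trans (normc_triangle _ _))// lerD//.
  by rewrite -mulr_natl normcM normc_nat mulr_natl lerMn2r aB orbT.
rewrite (le_trans (normc_sum _ _ _))// big_nat_cond [leRHS]big_nat_cond.
apply: ler_sum => j /andP[/andP[j1 jn] _].
by rewrite normcM ler_pM ?normc_ge0// ?(IH a w aB ca)// j1 -ltnS.
Qed.

Lemma recip_prod_coef_bound (A : R) w k : (forall x, x \in w -> normc x <= A) ->
  0 <= A -> normc (recip_prod w)`_k <= (1 + A) ^+ size w.
Proof.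
move=> + A0; elim: w k => [|x w IH] k wA.
  rewrite /recip_prod big_nil coef1 expr0.
  by case: eqP; rewrite ?normc_1 ?normc_0.
rewrite recip_prod_cons mulrBl mul1r -scalerAl coefB coefZ coefXM exprS mulrDl mul1r.
have {}IH j : normc (recip_prod w)`_j <= (1 + A) ^+ size w.
  by apply: IH => y yw; rewrite wA// inE yw orbT.
rewrite (le_trans (normc_sub_triangle _ _))// lerD// normcM ler_pM ?normc_ge0//.
  by rewrite wA// mem_head.
by case: eqP => // _; rewrite normc_0 exprn_ge0// addr_ge0.
Qed.

(** Only the degree of [Q] matters: [Q] may have real roots too, and [Q = 0] is allowed. This
    flexibility makes the class stable under differentiation. *)
Definition few_nonreal_roots M P := exists Q s,
  P = Q * \prod_(x <- s) ('X - x%:P) /\ (size Q <= M.+1)%N.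

(** The first-order sum is bounded with its signs: the sum of the moduli of the reciprocal roots
    need not stay bounded along a sequence. The signed sum later becomes a linear term in the
    exponent. *)
Definition bounded_form M (W : R) P := exists Q t,
  [/\ P = Q * recip_prod t, (size Q <= M.+1)%N, forall k, `|Q`_k| <= W,
      \sum_(x <- t) x ^+ 2 <= W & `|\sum_(x <- t) x| <= W].

Lemma few_nonreal_roots_factor M P : few_nonreal_roots M P -> P`_0 != 0 ->
  exists Q w t, [/\ P = Q * recip_prod t, (size Q <= M.+1)%N, (size w <= M)%N &
    map_poly toC Q = (P`_0)%:C *: recip_prod w].
Proof.
move=> [Q0 [s [PE QM]]] P0.
have s0 : 0 \notin s.
  apply: contra P0 => s0; rewrite -horner_coef0 PE hornerM horner_prod.
  by rewrite (big_rem 0)//= hornerXsubC subrr mul0r mulr0.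
pose Q := (\prod_(x <- s) - x) *: Q0.
have PQ : P = Q * recip_prod (map GRing.inv s).
  by rewrite PE recip_prod_XsubC// -scalerAr scalerAl.
have Q0E : Q`_0 = P`_0.
  rewrite -!horner_coef0 PQ hornerM horner_recip_prod big1 ?mulr1// => x _.
  by rewrite mulr0 subr0.
have [|w [wE sw]] := @recip_prod_closed _ (map_poly toC Q).
  by rewrite coef_map /= Q0E (inj_eq (@complexI R)).
have QM' : (size Q <= M.+1)%N by rewrite (leq_trans _ QM)// size_scale_leq.
exists Q, w, (map GRing.inv s); split => //.
  by rewrite -ltnS (leq_trans sw)// size_map_poly.
by rewrite {1}wE coef_map /= Q0E.
Qed.

(* An even power sum of the real reciprocal roots is nonnegative, so a power
   making all other reciprocal roots point to the right bounds those. *)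
Lemma a_priori_form M (B : nat -> R) (c : R) :
  (forall k, 0 <= B k) -> 0 < c -> exists2 W, 0 <= W &
  forall P, few_nonreal_roots M P -> (forall k, `|P`_k| <= B k) ->
    c <= `|P`_0| -> bounded_form M W P.
Proof.
move=> B0 c0; have [K KP] := simultaneous_even_power M.
(* The range contains every exponent [k.*2] with [k <= K], and also the exponents 1 and 2 even if
   [K] is 0. *)
have [b b0 bP] := @power_sum_bound B c K.*2.+2 B0 c0.
(* A nonreal reciprocal root [x] of modulus above [A] would have modulus above 1, hence at most
   [normc x ^+ k.*2], which is at most [2 * b]; this contradicts the choice of [A]. *)
pose A := 1 + 2 * b; have A1 : 1 <= A by rewrite lerDl mulr_ge0.
have A0 : 0 <= A by rewrite (le_trans ler01).
pose W1 := B 0 * (1 + A) ^+ M; pose W2 := b + A ^+ 2 *+ M; pose W3 := b + A *+ M.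
have W10 : 0 <= W1 by rewrite mulr_ge0// exprn_ge0// addr_ge0.
have W20 : 0 <= W2 by rewrite addr_ge0// mulrn_wge0// exprn_ge0.
have W30 : 0 <= W3 by rewrite addr_ge0// mulrn_wge0.
exists (W1 + W2 + W3); first exact: addr_ge0 (addr_ge0 W10 W20) W30.
move=> P PM PB cP; have P0 : P`_0 != 0 by rewrite -normr_gt0 (lt_le_trans c0).
have [Q [w [t [PE QM wM QE]]]] := few_nonreal_roots_factor PM P0.
have PC : map_poly toC P = (P`_0)%:C *: recip_prod (w ++ map toC t).
  rewrite PE rmorphM /= QE recip_prod_cat scalerAl -PE; congr (_ * _).
  rewrite /recip_prod rmorph_prod /= big_map; apply: eq_bigr => x _.
  by rewrite rmorphB /= rmorph1 map_polyZ /= map_polyX.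
have {bP} psb k : (0 < k <= K.*2.+2)%N ->
    normc (power_sum k w + (\sum_(x <- t) x ^+ k)%:C) <= b.
  move=> kK; have -> : power_sum k w + (\sum_(x <- t) x ^+ k)%:C =
      power_sum k (w ++ map toC t).
    rewrite /power_sum big_cat /= big_map rmorph_sum /=; congr (_ + _).
    by apply: eq_bigr => x _; rewrite rmorphXn.
  apply: (bP (P`_0)%:C) => //; last by rewrite normc_real.
  by move=> j; rewrite -PC coef_map normc_real.
have wA x : x \in w -> normc x <= A.
  have [k /andP[k0 kK] kP] := KP w wM.
  move=> xw; rewrite leNgt; apply/negP => Ax.
  have : normc x ^+ k.*2 <= 2 * b.
    rewrite (le_trans (kP x xw))// ler_wpM2l//.
    have := psb k.*2; rewrite double_gt0 k0 -doubleS leq_double (leq_trans kK)//.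
    move=> /(_ isT)/(le_trans (Re_le_normc _)); rewrite ler_norml => /andP[_].
    rewrite (_ : complex.Re (_ + _) =
      complex.Re (power_sum k.*2 w) + \sum_(x <- t) x ^+ k.*2); last first.
      by case: (power_sum _ _).
    have t0 : 0 <= \sum_(x <- t) x ^+ k.*2.
      by apply: sumr_ge0 => y _; rewrite -mul2n exprM exprn_ge0// sqr_ge0.
    have : complex.Re (x ^+ k.*2) <= complex.Re (power_sum k.*2 w).
      rewrite /power_sum (big_rem x)//= -[leLHS]addr0.
      rewrite (_ : complex.Re (_ + _) = complex.Re (x ^+ k.*2) +
        \sum_(y <- rem x w) complex.Re (y ^+ k.*2)); last first.
        rewrite -(raddf_sum (@complex.Re R : Rcomplex R -> R)).
        by case: (x ^+ _) => ? ?; case: (\sum_(i <- _) _).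
      rewrite lerD2l big_seq sumr_ge0// => y /mem_rem yw.
      have := kP y yw; have : 0 <= normc y ^+ k.*2 by rewrite exprn_ge0// normc_ge0.
      lra.
    lra.
  have : normc x <= normc x ^+ k.*2.
    by rewrite ler_eXnr ?double_gt0// ltW// (le_lt_trans A1).
  move: Ax; rewrite /A; lra.
(* The list [w] contributes at most [A ^+ k *+ M] to the real part of the full power sum; removing
   this contribution bounds the sums over [t]. *)
have Re1 k : `|complex.Re (power_sum k w)| <= A ^+ k *+ M.
  rewrite (le_trans (Re_le_normc _))// (le_trans (normc_sum _ _ _))//.
  rewrite (@le_trans _ _ (\sum_(x <- w) A ^+ k))//.
    rewrite big_seq [leRHS]big_seq ler_sum// => x xw.
    by rewrite normc_exp lerXn2r ?nnegrE ?normc_ge0 ?wA.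
  by rewrite big_const_seq count_predT iter_addr_0 ler_wpMn2l// exprn_ge0.
have tb k : (0 < k <= K.*2.+2)%N -> `|\sum_(x <- t) x ^+ k| <= b + A ^+ k *+ M.
  move=> /psb /(le_trans (Re_le_normc _)).
  rewrite (_ : complex.Re (_ + _) = complex.Re (power_sum k w) + \sum_(x <- t) x ^+ k); last first.
    by case: (power_sum _ _).
  move: (Re1 k); rewrite !ler_norml => /andP[? ?] /andP[? ?]; apply/andP; split; lra.
exists Q, t; split => //.
- move=> k; rewrite -normc_real -(coef_map toC) QE coefZ normcM normc_real.
  apply: (@le_trans _ _ W1); last by rewrite -addrA lerDl addr_ge0.
  rewrite ler_pM ?normc_ge0//.
  rewrite (le_trans (recip_prod_coef_bound _ wA A0))// ler_weXn2l// lerDl//.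
- by rewrite (le_trans (ler_norm _))// (le_trans (tb 2 _))// /W2; lra.
- have := tb 1 isT; rewrite expr1 -/W3.
  by under eq_bigr do rewrite expr1; move=> h; lra.
Qed.

End APriori.

(** * Rolle's theorem and the number of nonreal roots of derivatives *)

Section Rolle.
Variable R : realType.
Local Notation toC := (real_complex R).
Implicit Types (P Q : {poly R}).

(** Rolle's theorem is applied in each gap. The lower bound [x < y] carries distinctness through the
    induction; being outside [x :: s] later separates the new zeros from those that multiple roots
    leave in the derivative. *)
Lemma interlacing_roots_deriv P (x : R) s : path <%R x s -> all (root P) (x :: s) ->
  exists t, [/\ size t = size s, uniq t, all (root P^`()) t,
    all (fun y => x < y) t & all (fun y => y \notin x :: s) t].
Proof.
elim: s x => [|x' s IH] x /=; first by exists [::].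
move=> /andP[xx' pth] /andP[Px /andP[Px' Ps]].
have [|t [ts ut Pt xt nt]] := IH x' pth; first by rewrite /= Px'.
have [|y /andP[/= xy yx'] Py] := @poly_rolle R x x' P xx'.
  by rewrite (eqP Px) (eqP Px').
rewrite !bnd_simp in xy yx'.
have s_gt z : z \in s -> x' < z by move/(allP (order_path_min lt_trans pth)).
exists (y :: t); split => /=.
- by rewrite ts.
- by rewrite ut andbT; apply/negP => /(allP xt); rewrite ltNge ltW.
- by rewrite Pt andbT; apply/eqP.
- by rewrite xy/=; apply/allP => z /(allP xt); apply: lt_trans.
apply/andP; split.
  rewrite !inE !negb_or gt_eqF// lt_eqF//=.
  by apply/negP => /s_gt; rewrite ltNge ltW.
apply/allP => z zt; rewrite inE negb_or (allP nt z zt) andbT.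
by rewrite gt_eqF// (lt_trans xx')// (allP xt).
Qed.

(** Here [t] collects the repetitions: a root occurring m times in [s] occurs m - 1 times in [t], as
    it should for the derivative. *)
Lemma perm_undup_cat (T : eqType) (s : seq T) : exists t,
  perm_eq s (undup s ++ t) /\ {subset t <= s}.
Proof.
elim: s => [|x s [t [pt st]]] /=; first by exists [::].
case: ifP => xs.
  exists (x :: t); split; last first.
    by move=> y; rewrite !inE => /orP[->//|/st ->]; rewrite orbT.
  by rewrite perm_sym -cat1s perm_catCA /= perm_cons perm_sym.
exists t; split; first by rewrite perm_cons.
by move=> y /st ys; rewrite inE ys orbT.
Qed.

(** Each term of the derivative of the product over [t] misses a single factor, and the product over
    [s] supplies it. *)
Lemma dvd_mul_deriv_prod (s t : seq R) : {subset t <= s} ->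
  \prod_(x <- t) ('X - x%:P) %|
    \prod_(x <- s) ('X - x%:P) * (\prod_(x <- t) ('X - x%:P))^`().
Proof.
elim: t => [|x t IH] ts; first by rewrite !big_nil dvd1p.
rewrite big_cons derivM derivXsubC mul1r mulrDr dvdp_add//.
  rewrite (big_rem x (ts _ (mem_head _ _)))/= mulrAC.
    by rewrite dvdp_mulr.
rewrite mulrCA dvdp_mul2l ?polyXsubC_eq0//.
by apply: IH => y yt; rewrite ts// inE yt orbT.
Qed.

(** With d distinct roots in [s], the derivative has the repeated roots and d - 1 Rolle points as
    zeros. One real root is lost and the degree drops by at least one, so the cofactor is no larger
    than [Q]. *)
Lemma few_nonreal_roots_deriv M P :
  few_nonreal_roots M P -> few_nonreal_roots M P^`().
Proof.
move=> [Q [s [PE QM]]].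
have [P'0|P'0] := eqVneq P^`() 0.
  by exists 0, [::]; rewrite P'0 mul0r size_poly0.
case: s => [|x0 s0] in PE *.
  exists Q^`(), [::]; rewrite {1}PE !big_nil !mulr1; split => //.
  rewrite (leq_trans _ QM)//; apply/leq_sizeP => j jQ.
  by rewrite coef_deriv nth_default ?mul0rn// (leq_trans jQ).
set s := x0 :: s0 in PE.
have [t [pst st]] := perm_undup_cat s.
pose d := sort <=%R (undup s).
have dltt : sorted <%R d by rewrite lt_sorted_uniq_le sort_uniq undup_uniq sort_le_sorted.
pose D := \prod_(x <- d) ('X - x%:P); pose E := \prod_(x <- t) ('X - x%:P).
have PDE : P = Q * D * E.
  rewrite PE (perm_big _ pst)/= big_cat/= -mulrA; congr (_ * (_ * _)).
  by apply: perm_big; rewrite perm_sym perm_sort.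
have /dvdpP[G GE] : E %| D * E^`().
  by apply: dvd_mul_deriv_prod => y /st ys; rewrite mem_sort mem_undup.
pose r := Q^`() * D + Q * D^`() + Q * G.
have P'E : P^`() = r * E.
  rewrite PDE !derivM /r !mulrDl -(mulrA Q G) -GE mulrA.
  by congr (_ + _); rewrite -mulrA.
have dE : size s = (size d + size t)%N by rewrite (perm_size pst) size_cat size_sort.
have mem_d y : (y \in d) = (y \in s) by rewrite mem_sort mem_undup.
case dd : d => [|x d'].
  by have := mem_d x0; rewrite dd /s !inE eqxx.
rewrite dd /= in dltt.
have Proot y : y \in s -> root P y.
  by move=> ys; rewrite PE rootM root_prod_XsubC ys orbT.
have [|ys [yd' uys Pys _ nys]] := @interlacing_roots_deriv P x d' dltt.
  by rewrite -dd; apply/allP => y; rewrite mem_d; apply: Proot.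
(* The Rolle points lie outside [s], hence are not roots of [E]; as roots of the derivative [r * E]
   they must be roots of [r]. *)
have rys : all (root r) ys.
  apply/allP => y yys; have := allP Pys y yys; rewrite P'E rootM => /orP[//|].
  rewrite root_prod_XsubC => /st; rewrite -mem_d dd.
  by rewrite (negPf (allP nys y yys)).
have [|Q2 rE] := uniq_roots_prod_XsubC rys; first by rewrite uniq_rootsE.
have P'E2 : P^`() = Q2 * \prod_(x <- ys ++ t) ('X - x%:P).
  by rewrite P'E rE -mulrA big_cat.
exists Q2, (ys ++ t); split=> //.
have Q20 : Q2 != 0 by apply: contraNneq P'0; rewrite P'E2 => ->; rewrite mul0r.
have P0 : P != 0 by apply: contraNneq P'0 => ->; rewrite deriv0.
have Q0 : Q != 0 by apply: contraNneq P0; rewrite PE => ->; rewrite mul0r.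
have nz l : \prod_(x <- l) ('X - x%:P) != 0 :> {poly R}.
  by apply: monic_neq0; apply: monic_prod_XsubC.
have := lt_size_deriv P0; rewrite P'E2 PE !size_mul// !size_prod_XsubC dE dd /=.
rewrite size_cat yd'; move: QM.
by move: (size Q) (size Q2) (size d') (size t) => a b c e; lia.
Qed.

Lemma few_nonreal_roots_derivn M P k :
  few_nonreal_roots M P -> few_nonreal_roots M P^`(k).
Proof.
by move=> h; elim: k => [|k IH]//; rewrite derivnS; apply: few_nonreal_roots_deriv.
Qed.

Lemma few_nonreal_roots_shift M P a :
  few_nonreal_roots M P -> few_nonreal_roots M (P \Po ('X + a%:P)).
Proof.
move=> [Q [s [-> QM]]]; exists (Q \Po ('X + a%:P)), [seq x - a | x <- s]; split.
  rewrite comp_polyM; congr (_ * _).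
  elim: s => [|x s IH]; first by rewrite !big_nil comp_polyC.
  rewrite /= !big_cons comp_polyM IH; congr (_ * _).
  by rewrite comp_polyB comp_polyX comp_polyC polyCB opprB addrA.
by rewrite size_comp_poly2// size_XaddC.
Qed.

End Rolle.

(** * Real polynomials over [R[i]] and the count of their nonreal zeros *)

Section RealPolynomials.
Variable R : realType.
Local Notation toC := (real_complex R).
Implicit Type p : {poly R[i]}.

Lemma mup_prod_XsubC (F : fieldType) (z : F) (s : seq F) :
  mup z (\prod_(x <- s) ('X - x%:P)) = count_mem z s.
Proof.
elim: s => [|x s IH].
  by rewrite big_nil mupNroot// root1.
rewrite big_cons mupM ?polyXsubC_eq0 ?monic_neq0 ?monic_prod_XsubC// IH /=.
by rewrite -['X - _]expr1 mup_XsubCX; case: eqVneq.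
Qed.

Lemma real_lineE (z : R[i]) : real_line R z <-> complex.Im z = 0.
Proof.
split => [[x _ <-]//|]; case: z => a b /= ->.
by exists a.
Qed.

(** The polynomial with conjugate coefficients agrees with [p] at all natural numbers, where the
    values are real. Testing as many of them as the size of the difference shows that the two are
    equal, so the coefficients are real. *)
Lemma real_poly_map p : real_poly p -> exists P, p = map_poly toC P.
Proof.
move=> pr.
have conj_p : map_poly conjc p = p.
  apply/eqP; rewrite -subr_eq0; apply/eqP.
  pose rs : seq R[i] := [seq n%:R | n <- iota 0 (size (map_poly conjc p - p))].
  apply: (@roots_geq_poly_eq0 _ _ rs); last by rewrite size_map size_iota.
    apply/allP => _ /mapP[n _ ->]; rewrite rootE !hornerE.
    have -> : (map_poly conjc p).[n%:R] = conjc p.[n%:R].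
      by rewrite -horner_map /= conjc_nat.
    have : real_line R p.[n%:R].
      by apply: pr; exists n%:R => //; exists n%:R; rewrite ?rmorph_nat.
    by case=> x _ <-; rewrite conjc_real subrr.
  by rewrite map_inj_uniq ?iota_uniq// => m n /eqP; rewrite eqr_nat => /eqP.
exists (\poly_(k < size p) complex.Re p`_k); apply/polyP => k.
rewrite coef_map coef_poly; case: ltnP => [kp|kp]; last by rewrite nth_default// rmorph0.
have := congr1 (fun q : {poly R[i]} => q`_k) conj_p; rewrite coef_map /=.
case: (p`_k) => a b [] /eqP; rewrite eq_sym -subr_eq0 opprK -mulr2n mulrn_eq0 /=.
by move=> /eqP ->.
Qed.

(** The nonreal zeros are the distinct elements of the filtered list, each with its number of
    occurrences as multiplicity; regrouping that list by value yields its length. *)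
Lemma num_zeros_nonreal p (c : R[i]) (s : seq R[i]) : c != 0 ->
  p = c *: \prod_(z <- s) ('X - z%:P) ->
  num_zeros p (~` real_line R) = count (fun z => complex.Im z != 0) s.
Proof.
move=> c0 pE; rewrite /num_zeros.
have p0 : p != 0 by rewrite pE scaler_eq0 negb_or c0 monic_neq0// monic_prod_XsubC.
rewrite (negPf p0) -size_filter; set s' := [seq z <- s | _].
have -> : ~` real_line R `&` [set z | root p z] = [set` undup s'].
  apply/seteqP; split => z /=.
    move=> [nz]; rewrite pE rootZ// root_prod_XsubC => zs.
    rewrite mem_undup mem_filter zs andbT; apply/eqP => z0; apply: nz.
    exact/real_lineE.
  rewrite mem_undup mem_filter => /andP[z0 zs]; split.
    by move=> /real_lineE; apply/eqP.
  by rewrite pE rootZ// root_prod_XsubC.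
rewrite -fsbig_seq ?undup_uniq//.
have := big_undup_iterop_count addn s' xpredT (fun=> 1%N); rewrite sum1_size => <-.
rewrite [LHS]big_seq [RHS]big_seq; apply: eq_bigr => z; rewrite mem_undup mem_filter => /andP[z0 _].
have -> : mup z p = count_mem z s.
  rewrite pE -mul_polyC mupMr ?mup_prod_XsubC//.
  by rewrite rootC.
have -> : count_mem z s' = count_mem z s.
  rewrite count_filter; apply: eq_count => y /=.
  by case: eqVneq => //= ->.
by elim: (count_mem z s) => //= -[|n] //= <-.
Qed.

(** The product over the real roots divides [P] over [R[i]], and divisibility descends to [R].
    Comparing degrees, the degree of the quotient is the number of nonreal roots. *)
Lemma few_nonreal_roots_num_zeros M (P : {poly R}) :
  (num_zeros (map_poly toC P) (~` real_line R) <= M)%N -> few_nonreal_roots M P.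
Proof.
have [->|P0] := eqVneq P 0.
  by move=> _; exists 0, [::]; rewrite mul0r size_poly0.
set p := map_poly toC P; have p0 : p != 0 by rewrite map_poly_eq0.
have [s pE] := closed_field_poly_normal p.
rewrite (num_zeros_nonreal _ pE) ?lead_coef_eq0// => sM.
pose t := [seq complex.Re z | z <- s & complex.Im z == 0].
pose D := \prod_(x <- t) ('X - x%:P).
have DE : map_poly toC D = \prod_(z <- s | complex.Im z == 0) ('X - z%:P).
  rewrite /D rmorph_prod big_map big_filter; apply: eq_bigr => z /eqP z0.
  rewrite rmorphB /= map_polyX map_polyC /=; congr ('X - _%:P).
  by case: z z0 => a b /= ->.
have /dvdpP[Q PE] : D %| P.
  rewrite -(dvdp_map toC) -/p pE (bigID (fun z => complex.Im z == 0)) /= DE.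
  by rewrite -mul_polyC mulrCA dvdp_mulr.
exists Q, t; split=> //.
have Q0 : Q != 0 by apply: contraNneq P0; rewrite PE => ->; rewrite mul0r.
have : size P = (size s).+1.
  by rewrite -(size_map_poly toC) -/p pE size_scale ?lead_coef_eq0// size_prod_XsubC.
have D0 : D != 0 by rewrite monic_neq0// monic_prod_XsubC.
have sD : size D = (size t).+1 by exact: size_prod_XsubC.
rewrite PE size_mul// sD addnS /=.
have := count_predC (fun z : R[i] => complex.Im z == 0) s.
have -> : count (fun z : R[i] => complex.Im z == 0) s = size t.
  by rewrite /t size_map size_filter.
by move=> <- /eqP; rewrite addnC -addnS eqn_add2l => /eqP ->.
Qed.

End RealPolynomials.

(** * Limits in [R[i]] along filters and ultrafilters *)

Section ComplexLimits.
Variables (R : realType) (T : Type).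
Implicit Types (F : set_system T) (u v : T -> R[i]) (l m : R[i]).

(** Convergence in [R[i]] by coordinates, which gives direct access to real limit theorems;
    [ctends_cvgP] identifies it with convergence for the topology of [R[i]]. *)
Definition ctends F u l :=
  (fun x => complex.Re (u x)) @ F --> complex.Re l /\
  (fun x => complex.Im (u x)) @ F --> complex.Im l.

Lemma ctends_normcP F (FF : Filter F) u l : ctends F u l <->
  forall e : R, 0 < e -> \forall x \near F, normc (l - u x) < e.
Proof.
split=> [[/cvgrPdist_lt hR /cvgrPdist_lt hI] e e0|h]; last first.
  split; apply/cvgrPdist_lt => e /h; apply: filterS => x; apply: le_lt_trans.
    by rewrite (le_trans _ (Re_le_normc _))//; case: l (u x) {h} => a b [c d].
  by rewrite (le_trans _ (Im_le_normc _))//; case: l (u x) {h} => a b [c d].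
have e2 : 0 < e / 2 by rewrite divr_gt0.
apply: filterS2 (hR _ e2) (hI _ e2) => x.
move: (normc_le_ReIm (l - u x)); case: l (u x) {hR hI} => a b [c d] /=; lra.
Qed.

Lemma ctends_cvgP F (FF : Filter F) u l : ctends F u l <-> u @ F --> l.
Proof.
rewrite ctends_normcP; split=> [h|/cvgrPdist_lt h e e0].
  (* A positive element of [R[i]] has imaginary part 0, so complex radii reduce to real ones. *)
  apply/cvgrPdist_lt => -[e1 e2]; rewrite ltcE /= => /andP[/eqP ->] /h.
  by apply: filterS => x; rewrite norm_normc ltcR.
have := h e%:C; rewrite ltcR => /(_ e0); apply: filterS => x.
by rewrite norm_normc ltcR.
Qed.

Lemma ctends_cst F (FF : Filter F) l : ctends F (fun=> l) l.
Proof. by split; exact: cvg_cst. Qed.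

Lemma ctendsD F (FF : Filter F) u v l m : ctends F u l -> ctends F v m ->
  ctends F (fun x => u x + v x) (l + m).
Proof.
move=> [u1 u2] [v1 v2]; case: l m u1 u2 v1 v2 => a b [c d] /= u1 u2 v1 v2.
by split => /=; [under eq_fun do rewrite raddfD/=|under eq_fun do rewrite raddfD/=];
  apply: cvgD.
Qed.

Lemma ctendsM F (FF : Filter F) u v l m : ctends F u l -> ctends F v m ->
  ctends F (fun x => u x * v x) (l * m).
Proof.
move=> [u1 u2] [v1 v2]; split.
  rewrite (_ : complex.Re _ = complex.Re l * complex.Re m - complex.Im l * complex.Im m);
    last by case: l {u1 u2} => ? ?; case: m {v1 v2}.
  rewrite (_ : (fun _ => _) = fun x => complex.Re (u x) * complex.Re (v x) -
    complex.Im (u x) * complex.Im (v x)); last first.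
    by apply/funext => x; case: (u x) => ? ?; case: (v x).
  by apply: cvgB; apply: cvgM.
rewrite (_ : complex.Im _ = complex.Re l * complex.Im m + complex.Im l * complex.Re m);
  last by case: l {u1 u2} => ? ?; case: m {v1 v2}.
rewrite (_ : (fun _ => _) = fun x => complex.Re (u x) * complex.Im (v x) +
  complex.Im (u x) * complex.Re (v x)); last first.
  by apply/funext => x; case: (u x) => ? ?; case: (v x).
by apply: cvgD; apply: cvgM.
Qed.

Lemma ctendsB F (FF : Filter F) u v l m : ctends F u l -> ctends F v m ->
  ctends F (fun x => u x - v x) (l - m).
Proof.
move=> ul vm; rewrite -mulN1r; under eq_fun do rewrite -mulN1r.
by apply: ctendsD => //; apply: ctendsM => //; exact: ctends_cst.
Qed.

Lemma ctends_sum F (FF : Filter F) (I : Type) (r : seq I) (u : I -> T -> R[i])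
    (l : I -> R[i]) : (forall i, ctends F (u i) (l i)) ->
  ctends F (fun x => \sum_(i <- r) u i x) (\sum_(i <- r) l i).
Proof.
move=> ul; elim: r => [|i r IH].
  by rewrite big_nil; under eq_fun do rewrite big_nil; exact: ctends_cst.
by rewrite big_cons; under eq_fun do rewrite big_cons; exact: ctendsD.
Qed.

Lemma ctends_prod F (FF : Filter F) (I : Type) (r : seq I) (u : I -> T -> R[i])
    (l : I -> R[i]) : (forall i, ctends F (u i) (l i)) ->
  ctends F (fun x => \prod_(i <- r) u i x) (\prod_(i <- r) l i).
Proof.
move=> ul; elim: r => [|i r IH].
  by rewrite big_nil; under eq_fun do rewrite big_nil; exact: ctends_cst.
by rewrite big_cons; under eq_fun do rewrite big_cons; exact: ctendsM.
Qed.

Lemma ctends_real F (FF : Filter F) (u : T -> R) (l : R) :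
  u @ F --> l -> ctends F (fun x => (u x)%:C) l%:C.
Proof. by move=> ul; split => //=; exact: cvg_cst. Qed.

Lemma ctends_unique F (FF : ProperFilter F) u l m :
  ctends F u l -> ctends F u m -> l = m.
Proof.
move=> [u1 u2] [v1 v2]; apply/eqP; rewrite eq_complex.
by rewrite (cvg_unique _ u1 v1)// (cvg_unique _ u2 v2)// !eqxx.
Qed.

Lemma ctends_sub F G u l : G `<=` F -> ctends G u l -> ctends F u l.
Proof. by move=> GF [u1 u2]; split=> A hA; apply: GF; [exact: u1|exact: u2]. Qed.

Lemma ctends_normc_le F (FF : ProperFilter F) u l (B : R) :
  ctends F u l -> (\forall x \near F, normc (u x) <= B) -> normc l <= B.
Proof.
move=> /ctends_normcP ul uB; apply/ler_addgt0Pl => e e0.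
have [x [h1 h2]] := filter_ex (filterI (ul e e0) uB).
by rewrite (le_trans (normc_sub_le l (u x)))// addrC lerD// ltW.
Qed.

(** Segments are compact, so an ultrafilter on one converges. A single ultrafilter thus serves
    infinitely many bounded sequences at once, without diagonal extraction. *)
Lemma ultra_cvg_bounded F (FF : UltraFilter F) (u : T -> R) (B : R) :
  (forall x, `|u x| <= B) -> exists l : R, u @ F --> l.
Proof.
move=> uB; have := @segment_compact R (- B) B; rewrite compact_ultra.
move=> /(_ (u @ F) _) [].
(* The image of [F] under [u] is again ultra: if [A] in a finer [G] had a preimage outside [F], the
   complement of [A] would lie in [G] as well. *)
- apply: Build_UltraFilter; last first.
    move=> G GF sub; apply/seteqP; split=> // A GA.
    have [//|FA] := in_ultra_setVsetC (u @^-1` A) FF.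
    have : G (~` A) by apply: sub.
    move=> /(filterI GA); rewrite setICr => G0.
    by have /filter_ex[] := G0.
- by apply: nearW => x; rewrite /= in_itv /= -ler_norml.
- by move=> l [_ ul]; exists l.
Qed.

Lemma ultra_ctends_bounded F (FF : UltraFilter F) u (B : R) :
  (forall x, normc (u x) <= B) -> exists l, ctends F u l.
Proof.
move=> uB.
have [|a ua] := @ultra_cvg_bounded F FF (fun x => complex.Re (u x)) B.
  by move=> x; rewrite (le_trans (Re_le_normc _)).
have [|b ub] := @ultra_cvg_bounded F FF (fun x => complex.Im (u x)) B.
  by move=> x; rewrite (le_trans (Im_le_normc _)).
by exists (a +i* b).
Qed.

Lemma filter_forall_lt F (FF : Filter F) (P : nat -> T -> Prop) N :
  (forall k, (k < N)%N -> \forall x \near F, P k x) ->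
  \forall x \near F, forall k, (k < N)%N -> P k x.
Proof.
elim: N => [|N IH] h; first exact: filterE.
have := IH (fun k kN => h k (ltnW kN)).
apply: filterS2 (h N (ltnSn N)) => x PN Pk k; rewrite ltnS leq_eqVlt.
by move=> /orP[/eqP -> //|]; exact: Pk.
Qed.

End ComplexLimits.

(** * Locally bounded sequences of polynomials *)

Section CoefficientBounds.
Variable R : realType.
Implicit Types (p : nat -> {poly R[i]}) (q : {poly R[i]}) (a f : nat -> R[i]).

(** This and [coef_bounded] are equivalent: the version on discs suits translations, the version on
    coefficients suits antiderivatives. *)
Definition disc_bounded p := forall r : R, 0 <= r -> exists B : R,
  forall n z, normc z <= r -> normc (p n).[z] <= B.

Definition coef_bounded p := forall r : R, 0 <= r -> exists B : R,
  forall n k, normc (p n)`_k * r ^+ k <= B.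

Lemma sum_half_le N n : \sum_(N <= k < N + n) (2^-1 : R) ^+ k <= 2 * 2^-1 ^+ N.
Proof.
suff -> : \sum_(N <= k < N + n) (2^-1 : R) ^+ k = 2 * 2^-1 ^+ N - 2 * 2^-1 ^+ (N + n).
  by rewrite gerBl mulr_ge0// exprn_ge0// invr_ge0.
elim: n => [|n IH]; first by rewrite addn0 big_geq// subrr.
by rewrite addnS big_nat_recr ?leq_addr//= IH exprS; field.
Qed.

(** A coefficient bound at radius [2 * r] makes the terms on the disc of radius [r] decay
    geometrically with ratio 1/2. *)
Lemma power_sum_tail a (B r : R) z N n : 0 <= r ->
  (forall k, normc (a k) * (2 * r) ^+ k <= B) -> normc z <= r ->
  normc (\sum_(N <= k < N + n) a k * z ^+ k) <= 2 * B * 2^-1 ^+ N.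
Proof.
move=> r0 aB zr; rewrite (le_trans (normc_sum _ _ _))//.
have B0 : 0 <= B.
  by rewrite (le_trans _ (aB 0%N))// mulr_ge0 ?normc_ge0 ?exprn_ge0// mulr_ge0.
rewrite (mulrC 2) -mulrA (le_trans _ (ler_wpM2l B0 (sum_half_le N n)))//.
rewrite mulr_sumr; apply: ler_sum => k _.
rewrite normcM normc_exp exprVn -/(_ / _) ler_pdivlMr ?exprn_gt0// -mulrA.
rewrite (le_trans _ (aB k))// ler_wpM2l ?normc_ge0// exprMn mulrC.
by rewrite ler_wpM2l ?exprn_ge0// lerXn2r ?nnegrE ?normc_ge0.
Qed.

Lemma horner_tail q (B r : R) z N : 0 <= r ->
  (forall k, normc q`_k * (2 * r) ^+ k <= B) -> normc z <= r ->
  normc (q.[z] - \sum_(0 <= k < N) q`_k * z ^+ k) <= 2 * B * 2^-1 ^+ N.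
Proof.
move=> r0 qB zr; rewrite (horner_coef_wide z (leq_addl N (size q))).
rewrite -(big_mkord xpredT (fun k => q`_k * z ^+ k)).
rewrite [X in X - _](@big_cat_nat _ _ _ N) ?leq_addr//= addrAC subrr add0r.
exact: (@power_sum_tail (fun k => q`_k) B r z N (size q)).
Qed.

Lemma disc_bounded_coef p : disc_bounded p -> coef_bounded p.
Proof.
move=> pD r r0; have r10 : 0 < r + 1 by rewrite ltr_wpDl.
(* Doubling the radius absorbs the factor [2 ^+ k] of [circle_bound_coef]; adding 1 makes the radius
   positive. *)
have [|B pB] := pD (2 * (r + 1)); first by rewrite mulr_ge0// ltW.
exists B => n k.
have := @circle_bound_coef R (p n) B (2 * (r + 1)) k _ _.
rewrite mulr_gt0// => /(_ isT) h.
have {}h : normc (p n)`_k * (2 * (r + 1)) ^+ k <= 2 ^+ k * B.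
  by apply: h => z zr; rewrite pB ?zr.
rewrite exprMn mulrCA ler_pM2l ?exprn_gt0// in h.
rewrite (le_trans _ h)// ler_wpM2l ?normc_ge0// lerXn2r ?nnegrE ?(ltW r10)//.
by rewrite lerDl.
Qed.

Lemma coef_bounded_disc p : coef_bounded p -> disc_bounded p.
Proof.
move=> pC r r0; have [|B pB] := pC (2 * r); first by rewrite mulr_ge0.
exists (2 * B) => n z zr; have := @horner_tail (p n) B r z 0 r0 (pB n) zr.
by rewrite big_geq// subr0 expr0 mulr1.
Qed.

(** Integration divides the coefficient of index [k] by [k.+1], which only helps; the constant
    coefficient is invisible to the derivative and is bounded by [C]. *)
Lemma coef_bounded_antideriv p (C : R) : (forall n, normc (p n)`_0 <= C) ->
  coef_bounded (fun n => (p n)^`()) -> coef_bounded p.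
Proof.
move=> pC p'C r r0; have [B pB] := p'C r r0.
have C0 : 0 <= C by rewrite (le_trans _ (pC 0%N))// normc_ge0.
have B0 : 0 <= B.
  by rewrite (le_trans _ (pB 0%N 0%N))// mulr_ge0 ?normc_ge0 ?exprn_ge0.
exists (C + B * r) => n [|k].
  by rewrite expr0 mulr1 (le_trans (pC n))// lerDl mulr_ge0.
rewrite ler_wpDl// exprSr mulrA ler_wpM2r// (le_trans _ (pB n k))//.
rewrite ler_wpM2r ?exprn_ge0// coef_deriv -mulr_natr normcM normc_nat.
by rewrite ler_peMr ?normc_ge0// ler1n.
Qed.

Lemma disc_bounded_shift p (c : R[i]) :
  disc_bounded p -> disc_bounded (fun n => p n \Po ('X + c%:P)).
Proof.
move=> pD r r0; have [|B pB] := pD (r + normc c); first by rewrite addr_ge0 ?normc_ge0.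
exists B => n z zr; rewrite horner_comp !hornerE pB//.
by rewrite (le_trans (normc_triangle _ _))// lerD2r.
Qed.

End CoefficientBounds.

(** * From convergence of coefficients to locally uniform convergence *)

Section WeakLimit.
Variable R : realType.
Variables (p : nat -> {poly R[i]}) (f : nat -> R[i]).
Hypothesis p_bounded : coef_bounded p.
Hypothesis p_coef : forall k, ctends \oo (fun n => (p n)`_k) (f k).

Lemma limit_coef_bounded (r : R) : 0 <= r ->
  exists B : R, forall k, normc (f k) * r ^+ k <= B.
Proof.
move=> r0; have [B pB] := p_bounded r0; exists B => k.
have rk : normc (r ^+ k)%:C = r ^+ k by rewrite normc_real ger0_norm// exprn_ge0.
rewrite -rk -normcM.
apply: (ctends_normc_le _ (ctendsM _ (p_coef k) (ctends_cst _ _))).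
by apply: nearW => n; rewrite normcM rk.
Qed.

Lemma power_series_ctends z : ctends \oo (power_series f z) (power_series_sum f z).
Proof.
apply/ctends_cvgP; suff [l /ctends_cvgP/cvgP//] : exists l, ctends \oo (power_series f z) l.
have [|B fB] := @limit_coef_bounded (2 * normc z); first by rewrite mulr_ge0 ?normc_ge0.
have term k : normc (f k * z ^+ k) <= B * 2^-1 ^+ k.
  rewrite exprVn -/(_ / _) ler_pdivlMr ?exprn_gt0// normcM normc_exp -mulrA.
  by rewrite (le_trans _ (fB k))// exprMn (mulrC (2 ^+ k)).
have real_cvg (u : nat -> R) : (forall k, `|u k| <= B * 2^-1 ^+ k) -> cvgn (series u).
  move=> uB; apply: normed_cvg.
  apply: (@series_le_cvg _ _ (geometric B 2^-1)) => [k|k|k|] //=.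
    by rewrite (le_trans _ (uB k)).
  by apply: is_cvg_geometric_series; rewrite ger0_norm ?invr_ge0// invf_lt1// ltr1n.
exists (limn (series (fun k => complex.Re (f k * z ^+ k))) +i*
        limn (series (fun k => complex.Im (f k * z ^+ k)))).
split => /=.
  rewrite (_ : (fun n => _) = series (fun k => complex.Re (f k * z ^+ k))).
    by apply: real_cvg => k; rewrite (le_trans (Re_le_normc _)).
  apply/funext => n; rewrite /power_series /series /=.
  exact: (raddf_sum (@complex.Re R : Rcomplex R -> R)).
rewrite (_ : (fun n => _) = series (fun k => complex.Im (f k * z ^+ k))).
  by apply: real_cvg => k; rewrite (le_trans (Im_le_normc _)).
apply/funext => n; rewrite /power_series /series /=.
exact: (raddf_sum (@complex.Im R : Rcomplex R -> R)).
Qed.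

Lemma power_series_tail (B r : R) z N : 0 <= r ->
  (forall k, normc (f k) * (2 * r) ^+ k <= B) -> normc z <= r ->
  normc (power_series_sum f z - \sum_(0 <= k < N) f k * z ^+ k) <=
    2 * B * 2^-1 ^+ N.
Proof.
move=> r0 fB zr.
apply: (ctends_normc_le _ (ctendsD _ (power_series_ctends z) (ctends_cst _ _))).
exists N => // n /= Nn; rewrite /power_series /series /=.
rewrite (@big_cat_nat _ _ _ N)//= addrAC subrr add0r.
by rewrite -(subnKC Nn); apply: (@power_sum_tail _ f _ r).
Qed.

(** Cut at [N], both tails are below [e / 4] by the common coefficient bound, and the finitely many
    leading coefficients converge. *)
Lemma uniform_on_discs (r e : R) : 0 <= r -> 0 < e -> \forall n \near \oo,
  forall z, normc z <= r -> normc (power_series_sum f z - (p n).[z]) < e.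
Proof.
move=> r0 e0; have r20 : 0 <= 2 * r by rewrite mulr_ge0.
have [B1 pB] := p_bounded r20; have [B2 fB] := limit_coef_bounded r20.
pose B := `|B1| + `|B2| + 1.
have B0 : 0 < B by rewrite ltr_wpDl// addr_ge0.
have {}pB n k : normc (p n)`_k * (2 * r) ^+ k <= B.
  rewrite (le_trans (pB n k))// (le_trans (ler_norm _))//.
  by rewrite /B; have := normr_ge0 B2; lra.
have {}fB k : normc (f k) * (2 * r) ^+ k <= B.
  rewrite (le_trans (fB k))// (le_trans (ler_norm _))//.
  by rewrite /B; have := normr_ge0 B1; lra.
have [N NB] : exists N, 2 * B * 2^-1 ^+ N < e / 4.
  have : (geometric (2 * B) 2^-1 : R^nat) @ \oo --> (0 : R).
    by apply: cvg_geometric; rewrite ger0_norm ?invr_ge0// invf_lt1// ltr1n.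
  have e4 : 0 < e / 4 by rewrite divr_gt0.
  move=> /cvgrPdist_lt /(_ _ e4) [N _ /(_ N (leqnn N))] /=.
  by rewrite sub0r normrN => h; exists N; rewrite (le_lt_trans (ler_norm _)).
(* With this precision [N] terms, each with [normc z ^+ k] at most [(r + 1) ^+ N], add up to at most
   [e / 4]; [N.+1] avoids a division by 0. *)
have d0 : 0 < e / 4 / N.+1%:R / (r + 1) ^+ N.
  by rewrite !divr_gt0// ?exprn_gt0// ltr_wpDl.
have : \forall n \near \oo, forall k, (k < N)%N ->
    normc (f k - (p n)`_k) < e / 4 / N.+1%:R / (r + 1) ^+ N.
  by apply: filter_forall_lt => k _; move/ctends_normcP: (p_coef k) => /(_ _ d0).
apply: filterS => n pn z zr.
have r1 : 1 <= r + 1 by rewrite lerDr.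
have sumN : normc (\sum_(0 <= k < N) f k * z ^+ k - \sum_(0 <= k < N) (p n)`_k * z ^+ k)
    <= e / 4.
  rewrite -sumrB (le_trans (normc_sum _ _ _))//.
  apply: (@le_trans _ _ (\sum_(0 <= k < N) e / 4 / N.+1%:R)).
    rewrite big_nat_cond [leRHS]big_nat_cond ler_sum// => k /andP[/andP[_ kN] _].
    rewrite -mulrBl normcM normc_exp.
    have zk : normc z ^+ k <= (r + 1) ^+ N.
      rewrite (@le_trans _ _ ((r + 1) ^+ k))//.
        rewrite lerXn2r ?nnegrE ?normc_ge0 ?addr_ge0//.
        by rewrite (le_trans zr)// lerDl.
      by rewrite ler_weXn2l// ltnW.
    rewrite (le_trans (ler_pM _ _ (ltW (pn k kN)) zk)) ?normc_ge0 ?exprn_ge0 ?normc_ge0//.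
    by rewrite divfK// gt_eqF// exprn_gt0// (lt_le_trans ltr01).
  rewrite big_const_nat subn0 iter_addr_0 -[_ *+ N]mulr_natr -mulrA ler_piMr ?divr_ge0 ?(ltW e0)//.
  by rewrite mulrC ler_pdivrMr// mul1r ler_nat.
have h1 := power_series_tail N r0 fB zr.
have h2 := horner_tail N r0 (pB n) zr.
set S := \sum_(0 <= k < N) f k * z ^+ k in sumN h1.
set S' := \sum_(0 <= k < N) _ in sumN h2.
rewrite (_ : _ - _ = (power_series_sum f z - S) + (S - S') - ((p n).[z] - S')); last by ring.
rewrite (le_lt_trans (normc_sub_triangle _ _))//.
have := normc_triangle (power_series_sum f z - S) (S - S'); lra.
Qed.

Lemma horner_ctends z : ctends \oo (fun n => (p n).[z]) (power_series_sum f z).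
Proof.
apply/ctends_normcP => e e0.
by apply: filterS (uniform_on_discs (normc_ge0 z) e0) => n; apply.
Qed.

Lemma radius_of_convergence_infinite : radius_of_convergence f = +oo%E.
Proof.
apply/eqyP => A A0; rewrite /radius_of_convergence.
apply: ereal_sup_ubound; exists (A%:C).
  exact: (cvgP _ ((ctends_cvgP _ _ _).1 (power_series_ctends _))).
by rewrite normc_real gtr0_norm.
Qed.

Lemma strongly_converges_discs :
  strongly_converges (fun n => horner (p n)) (power_series_sum f).
Proof.
move=> K Kc P hP; have [E [EE EP]] := (@uniform_nbhs _ _ _ _ _).1 hP.
rewrite -entourage_ballE in EE; case: EE => -[e e2] /=.
rewrite ltcE /= => /andP[/eqP -> e0] eE.
(* A compact set lies in a disc, since its image under the continuous modulus is compact, hence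
   bounded. *)
have [r r0 rK] : exists2 r : R, 0 <= r & forall z, K z -> normc z <= r.
  have normc_cont : continuous (fun z : R[i] => normc z).
    move=> z A /nbhs_ballP[eps /= eps0 epsA]; exists eps%:C; first by rewrite /= ltcR.
    move=> w /=; rewrite norm_normc ltcR => zw; apply: epsA.
    rewrite -ball_normE /=; apply: le_lt_trans zw.
    rewrite ler_norml; apply/andP; split.
      by rewrite lerBrDl -lerBrDr opprK addrC normc_subC addrC normc_sub_le.
    by rewrite lerBlDl normc_sub_le.
  have /compact_bounded[M [_ MK]] : compact ((fun z => normc z) @` K).
    by apply: continuous_compact => //; exact: continuous_subspaceT.
  exists (`|M| + 1); first by rewrite addr_ge0.
  have M1 : M < `|M| + 1 by rewrite (le_lt_trans (ler_norm M))// ltrDl.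
  move=> z Kz; have /= := MK _ M1 (normc z).
  by rewrite ger0_norm ?normc_ge0//; apply; exists z.
apply: filterS (uniform_on_discs r0 e0) => n np; apply: EP => z /rK /np h.
by apply: eE; rewrite /= -ball_normE /= norm_normc ltcR.
Qed.

End WeakLimit.

(** Expand around [z]: the linear coefficients are bounded, so they have a limit [c] along [U], and
    the remainder after the linear term is at most [2 * B * normc h ^+ 2] for all [n]. This passes
    to the limit and makes [c] the derivative. *)
Lemma entire_ultra_limit (R : realType) (U : set_system nat) (UU : UltraFilter U)
    (p : nat -> {poly R[i]}) (G : R[i] -> R[i]) : disc_bounded p ->
  (forall z, ctends U (fun n => (p n).[z]) (G z)) -> entire G.
Proof.
move=> pD pG z.
have qC := disc_bounded_coef (disc_bounded_shift z pD).
set q := (fun n => _) in qC.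
have qE n h : (p n).[z + h] = (q n).[h] by rewrite horner_comp !hornerE addrC.
have [//|B qB] := qC 2.
have B0 : 0 <= B by rewrite (le_trans _ (qB 0%N 0%N))// mulr_ge0 ?normc_ge0.
have [|c q1c] := @ultra_ctends_bounded R nat U UU (fun n => (q n)`_1) B.
  move=> n; rewrite (le_trans _ (qB n 1%N))// expr1.
  by rewrite ler_peMr ?normc_ge0// ler1n.
have quad h : normc h <= 1 -> normc (G (z + h) - G z - c * h) <= 2 * B * normc h ^+ 2.
  move=> h1.
  have lim : ctends U (fun n => (p n).[z + h] + (-1) * (p n).[z] + (-1) * ((q n)`_1 * h))
      (G (z + h) + (-1) * G z + (-1) * (c * h)).
    do !apply: ctendsD => //; (apply: ctendsM; first exact: ctends_cst) => //.
    by apply: ctendsM => //; exact: ctends_cst.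
  rewrite -mulN1r -[- (c * h)]mulN1r; apply: (ctends_normc_le _ lim).
  apply: nearW => n; rewrite qE -[X in -1 * _.[X]](addr0 z) qE horner_coef0.
  have -> : (q n).[h] + -1 * (q n)`_0 + -1 * ((q n)`_1 * h) =
      (drop_poly 2 (q n)).[h] * h ^+ 2.
    rewrite -{1}(poly_take_drop 2 (q n)) !hornerE horner_poly !big_ord_recr big_ord0 /=.
    by rewrite expr0 expr1; ring.
  rewrite normcM normc_exp ler_wpM2r ?exprn_ge0 ?normc_ge0//.
  have := @horner_tail R (drop_poly 2 (q n)) B 1 h 0 ler01 _ h1.
  rewrite big_geq// subr0 expr0 !mulr1; apply=> k.
  rewrite coef_drop_poly (le_trans _ (qB n (k + 2)%N))//.
  by rewrite ler_wpM2l ?normc_ge0// ler_weXn2l ?leq_addr// ler1n.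
apply: (@cvgP _ _ c); apply/ctends_cvgP; apply/ctends_normcP => e e0.
pose d : R := Num.min 1 (e / (2 * B + 1)).
have B1 : 0 < 2 * B + 1 by rewrite ltr_wpDl// mulr_ge0.
have d0 : 0 < d by rewrite lt_min ltr01 divr_gt0.
exists d%:C; first by rewrite /= ltcR.
move=> h /=; rewrite norm_normc ltcR sub0r normc_opp lt_min => /andP[h1 hd] h0.
rewrite [h *: 1]mulr1 (addrC h).
have -> : c - h^-1 *: (G (z + h) - G z) = - (h^-1 * (G (z + h) - G z - c * h)).
  rewrite [_ *: _]/(_ * _) mulrBr opprB; congr (_ - _).
  by rewrite mulrCA mulVf ?mulr1.
rewrite normc_opp normcM normcV ltr_pdivrMl ?normc_gt0//.
rewrite (le_lt_trans (quad h (ltW h1)))// expr2 mulrCA.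
rewrite ltr_pM2l ?normc_gt0//.
move: hd; rewrite ltr_pdivlMr//; have := normc_ge0 h; nra.
Qed.

(** * Growth of polynomials in bounded form, and change of centre *)

Section Growth.
Variable R : realType.
Local Notation toC := (real_complex R).
Implicit Types (P Q : {poly R}) (t : seq R) (z : R[i]).

(** After squaring this is [1 + u <= expR u], with [1 + u] the squared modulus of the factor. The
    linear term keeps its sign, so a product over roots involves only their signed sum. *)
Lemma normc_linear_factor (x : R) z :
  normc (1 - x%:C * z) <= expR (- (x * complex.Re z) + x ^+ 2 * normc z ^+ 2 / 2).
Proof.
rewrite -(@ler_pXn2r _ 2)// ?nnegrE ?normc_ge0 ?expR_ge0//.
rewrite -expRM_natl.
have := expR_ge1Dx ((- (x * complex.Re z) + x ^+ 2 * normc z ^+ 2 / 2) *+ 2).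
rewrite -[_ *+ 2]mulr_natl !sqr_normc_ReIm; apply: le_trans.
by case: z => a b /=; lra.
Qed.

Lemma normc_recip_prod_le t z (A S r : R) :
  `|\sum_(x <- t) x| <= A -> \sum_(x <- t) x ^+ 2 <= S -> normc z <= r ->
  normc (recip_prod (map toC t)).[z] <= expR (r * A + r ^+ 2 * S).
Proof.
move=> tA tS zr; rewrite horner_recip_prod big_map normc_prod.
have r0 : 0 <= r by rewrite (le_trans _ zr)// normc_ge0.
apply: (@le_trans _ _ (\prod_(x <- t)
    expR (- (x * complex.Re z) + x ^+ 2 * normc z ^+ 2 / 2))).
  by apply: ler_prod => x _; rewrite normc_ge0 normc_linear_factor.
rewrite -expR_sum ler_expR big_split /= sumrN -!mulr_suml lerD//.
  rewrite (le_trans (ler_norm _))// normrN normrM mulrC ler_pM//.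
  by rewrite (le_trans (Re_le_normc _)).
have t2 : 0 <= \sum_(x <- t) x ^+ 2 by apply: sumr_ge0 => x _; exact: sqr_ge0.
have z2 : normc z ^+ 2 <= r ^+ 2 by rewrite lerXn2r ?nnegrE ?normc_ge0.
have z20 : 0 <= normc z ^+ 2 by exact: sqr_ge0.
rewrite (@le_trans _ _ (normc z ^+ 2 * \sum_(x <- t) x ^+ 2))//.
  by rewrite mulrC; nra.
by rewrite ler_pM.
Qed.

Lemma map_recip_prod t : map_poly toC (recip_prod t) = recip_prod (map toC t).
Proof.
rewrite /recip_prod rmorph_prod /= big_map; apply: eq_bigr => x _.
by rewrite rmorphB /= rmorph1 map_polyZ /= map_polyX.
Qed.

Lemma normc_horner_coef_le Q (W r : R) M z : (size Q <= M.+1)%N ->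
  (forall k, `|Q`_k| <= W) -> normc z <= r ->
  normc (map_poly toC Q).[z] <= W * (1 + r) ^+ M *+ M.+1.
Proof.
move=> QM QW zr; have r0 : 0 <= r by rewrite (le_trans _ zr)// normc_ge0.
have W0 : 0 <= W by rewrite (le_trans _ (QW 0%N)).
rewrite (le_trans (normc_horner_le _ zr))// size_map_poly.
apply: (@le_trans _ _ (\sum_(k < size Q) W * (1 + r) ^+ M)).
  apply: ler_sum => k _; rewrite coef_map normc_real ler_pM ?exprn_ge0//.
  rewrite (@le_trans _ _ ((1 + r) ^+ k))//.
    by rewrite lerXn2r ?nnegrE ?addr_ge0// lerDr.
  by rewrite ler_weXn2l ?lerDl// -ltnS (leq_trans (ltn_ord k)).
rewrite sumr_const card_ord ler_wpMn2l// mulr_ge0// exprn_ge0// addr_ge0//.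
Qed.

Lemma bounded_form_growth M (W r : R) P z : bounded_form M W P -> normc z <= r ->
  normc (map_poly toC P).[z] <= W * (1 + r) ^+ M *+ M.+1 * expR (r * W + r ^+ 2 * W).
Proof.
move=> [Q [t [-> QM QW t2 t1]]] zr.
rewrite rmorphM /= map_recip_prod hornerM normcM ler_pM ?normc_ge0//.
  exact: normc_horner_coef_le.
exact: normc_recip_prod_le.
Qed.

Lemma size_recip_prod t : (size (recip_prod t) <= (size t).+1)%N.
Proof.
elim: t => [|x t IH]; first by rewrite /recip_prod big_nil size_poly1.
rewrite recip_prod_cons (leq_trans (size_polyMleq _ _))//.
have : (size (1 - x *: 'X : {poly R})%R <= 2)%N.
  rewrite (leq_trans (size_polyD _ _))// geq_max size_poly1 size_polyN /=.
  by rewrite (leq_trans (size_scale_leq _ _))// size_polyX.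
by move: IH => /=; move: (size t) (size (polyseq _)) (size (polyseq _)) => a b c; lia.
Qed.

(** Each factor satisfies 1 - x (X - c) = (1 + x c) (1 - (x / (1 + x c)) X), and the scalars
    multiply to the value at [- c]. *)
Lemma recip_prod_shift t (c : R) : (forall x, x \in t -> 1 + x * c != 0) ->
  recip_prod t \Po ('X - c%:P) =
  (recip_prod t).[- c] *: recip_prod [seq x / (1 + x * c) | x <- t].
Proof.
elim: t => [|x t IH] tc; first by rewrite /recip_prod /= !big_nil comp_polyC hornerE scale1r.
have xc := tc x (mem_head _ _).
rewrite /= !recip_prod_cons comp_polyM IH => [|y yt]; last by rewrite tc// inE yt orbT.
rewrite -scalerAr hornerM (mulrC (1 - x *: 'X).[- c]) -scalerA.
congr (_ *: _); rewrite scalerAl; congr (_ * _).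
rewrite comp_polyB comp_polyC comp_polyZ comp_polyX !hornerE mulrN opprK.
rewrite [RHS]scalerBr scalerA mulrCA mulfV// mulr1 -!mul_polyC polyCD polyCM.
by ring.
Qed.

(* Reciprocal roots x with |x c| > 1/2, of which there are boundedly many, are
   moved to the first factor; the others become x / (1 + x c). *)
Lemma bounded_form_shift M (W c : R) : 0 <= W -> exists M' W', forall P,
  bounded_form M W (P \Po ('X + c%:P)) -> bounded_form M' W' P.
Proof.
(* A root with |x c| > 1/2 contributes more than 1 to 4 c^2 times the sum of squares, which bounds
   the number of such roots. *)
move=> W0; pose M' := (M + Num.truncn (4 * c ^+ 2 * W))%N.
pose A := W + 2 * `|c| * W.
have A0 : 0 <= A by rewrite addr_ge0// mulr_ge0// mulr_ge0.
pose r := 1 + `|c|; have r0 : 0 <= r by rewrite addr_ge0.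
(* [B] bounds the new first factor on the unit circle: the first exponential is for the scalar [g],
   the rest for [Q] and the moved roots at [z - c], of modulus at most [r]. *)
pose B := expR (`|c| * A + `|c| ^+ 2 * W) *
  (W * (1 + r) ^+ M *+ M.+1 * expR (r * A + r ^+ 2 * W)).
have B0 : 0 <= B.
  rewrite mulr_ge0 ?expR_ge0// mulr_ge0 ?expR_ge0// mulrn_wge0// mulr_ge0//.
  by rewrite exprn_ge0// addr_ge0.
(* The three terms serve the three bounds in turn: [circle_bound_coef] at radius 1 for the
   coefficients, 1 + x c >= 1/2 for the squares, and x / (1 + x c) = x - x^2 c / (1 + x c) for the
   signed sum. *)
exists M', (2 ^+ M' * B + 4 * W + (A + 2 * `|c| * W)) => P [Q [t [PE QM QW t2 t1]]].
pose big x := 2^-1 < `|x * c|.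
pose tb := [seq x <- t | big x]; pose ts := [seq x <- t | ~~ big x].
have split_sum (f : R -> R) : \sum_(x <- t) f x = \sum_(x <- tb) f x + \sum_(x <- ts) f x.
  by rewrite /tb /ts !big_filter (bigID big).
have sq0 (s : seq R) : 0 <= \sum_(x <- s) x ^+ 2.
  by apply: sumr_ge0 => x _; exact: sqr_ge0.
have tb2 : \sum_(x <- tb) x ^+ 2 <= W.
  by rewrite (le_trans _ t2)// split_sum lerDl.
have ts2 : \sum_(x <- ts) x ^+ 2 <= W.
  by rewrite (le_trans _ t2)// split_sum lerDr.
(* For the moved roots |x| <= 2 |c| x^2, so even the sum of their moduli is controlled by the
   squares. *)
have tb1 : `|\sum_(x <- tb) x| <= 2 * `|c| * W.
  rewrite (le_trans (ler_norm_sum _ _ _))//.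
  rewrite (le_trans _ (ler_wpM2l _ tb2)) ?mulr_ge0// mulr_sumr.
  rewrite /tb !big_filter; apply: ler_sum => x; rewrite /big normrM.
  by rewrite -(real_normK (num_real x)); have := normr_ge0 x; nra.
have tbA : `|\sum_(x <- tb) x| <= A by rewrite (le_trans tb1)// lerDr.
have tsA : `|\sum_(x <- ts) x| <= A.
  have -> : \sum_(x <- ts) x = \sum_(x <- t) x - \sum_(x <- tb) x.
    by rewrite (split_sum id) addrAC subrr add0r.
  by rewrite (le_trans (ler_normB _ _))// lerD.
have tbM : (size tb <= Num.truncn (4 * c ^+ 2 * W))%N.
  rewrite truncn_ge_nat; last by rewrite mulr_ge0// mulr_ge0// sqr_ge0.
  apply: (le_trans _ (ler_wpM2l _ tb2)); last by rewrite mulr_ge0// sqr_ge0.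
  rewrite mulr_sumr -sum1_size natr_sum /tb !big_filter; apply: ler_sum => x; rewrite /big => xc.
  rewrite -mulrA -exprMn (mulrC c) -(real_normK (num_real (x * c))); nra.
pose u (x : R) := x / (1 + x * c).
have small x : x \in ts -> 2^-1 <= 1 + x * c.
  by rewrite mem_filter /big -leNgt => /andP[+ _]; rewrite ler_norml => /andP[]; lra.
pose g := (recip_prod ts).[- c].
have gE : recip_prod ts \Po ('X - c%:P) = g *: recip_prod (map u ts).
  apply: recip_prod_shift => x /small xc; rewrite gt_eqF//; lra.
have gB : `|g| <= expR (`|c| * A + `|c| ^+ 2 * W).
  rewrite -(normc_real g) /g -(horner_map toC) /= map_recip_prod normc_recip_prod_le//.
  by rewrite normc_real normrN.
pose Q' := g *: ((Q * recip_prod tb) \Po ('X - c%:P)).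
have PQ' : P = Q' * recip_prod (map u ts).
  have -> : P = (P \Po ('X + c%:P)) \Po ('X - c%:P).
    by rewrite -comp_polyA comp_polyD comp_polyX comp_polyC subrK comp_polyXr.
  have perm_t : recip_prod t = recip_prod tb * recip_prod ts.
    by rewrite /recip_prod /tb /ts !big_filter (bigID big).
  by rewrite PE perm_t mulrA comp_polyM gE /Q' -scalerAl -scalerAr.
have sQ' : (size Q' <= M'.+1)%N.
  rewrite (leq_trans (size_scale_leq _ _))// size_comp_poly2 ?size_XsubC//.
  rewrite (leq_trans (size_polyMleq _ _))// /M'.
  move: QM tbM (size_recip_prod tb).
  by move: (size Q) (size (recip_prod tb)) (size tb) (Num.truncn _) => a b d N; lia.
have Q'B z : normc z = 1 -> normc (map_poly toC Q').[z] <= B.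
  move=> z1; rewrite map_polyZ hornerZ normcM normc_real.
  rewrite map_comp_poly /= rmorphB /= map_polyX map_polyC /= horner_comp.
  rewrite rmorphM /= hornerM normcM map_recip_prod hornerXsubC.
  have zr : normc (z - c%:C) <= r.
    by rewrite (le_trans (normc_sub_triangle _ _))// z1 normc_real.
  apply: ler_pM => //; first by rewrite mulr_ge0 ?normc_ge0.
  rewrite ler_pM ?normc_ge0//.
    exact: normc_horner_coef_le.
  exact: normc_recip_prod_le.
exists Q', (map u ts); split => //.
- move=> k; have W'0 : 0 <= 4 * W + (A + 2 * `|c| * W).
    by rewrite addr_ge0// ?mulr_ge0// addr_ge0// mulr_ge0// mulr_ge0.
  rewrite -addrA ler_wpDr//; have [kM|Mk] := leqP k M'; last first.
    by rewrite nth_default ?(leq_trans sQ')// normr0 mulr_ge0// exprn_ge0.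
  have := circle_bound_coef k ltr01 Q'B; rewrite coef_map normc_real expr1n mulr1.
  by move=> /le_trans; apply; rewrite ler_wpM2r// ler_weXn2l// ler1n.
- have h0 : 0 <= 2 ^+ M' * B by rewrite mulr_ge0// exprn_ge0.
  have h1 : 0 <= A + 2 * `|c| * W by rewrite addr_ge0// mulr_ge0// mulr_ge0.
  suff : \sum_(x <- map u ts) x ^+ 2 <= 4 * W by move: h0 h1; lra.
  rewrite big_map (le_trans _ (ler_wpM2l _ ts2))// mulr_sumr big_seq [leRHS]big_seq.
  apply: ler_sum => x /small xc; rewrite /u exprMn mulrC ler_wpM2r ?sqr_ge0//.
  rewrite exprVn -[4]invrK lef_pV2 ?posrE ?exprn_gt0//; last lra.
  by nra.
- have h0 : 0 <= 2 ^+ M' * B by rewrite mulr_ge0// exprn_ge0.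
  suff : `|\sum_(x <- map u ts) x| <= A + 2 * `|c| * W by move: h0; lra.
  have -> : \sum_(x <- map u ts) x =
      \sum_(x <- ts) x - \sum_(x <- ts) x ^+ 2 * (c / (1 + x * c)).
    rewrite big_map -sumrB big_seq [RHS]big_seq; apply: eq_bigr => x /small xc.
    by rewrite /u; field; rewrite gt_eqF//; lra.
  rewrite (le_trans (ler_normB _ _))// lerD// (le_trans (ler_norm_sum _ _ _))//.
  apply: (le_trans _ (ler_wpM2l _ ts2)); last by rewrite mulr_ge0.
  rewrite mulr_sumr big_seq [leRHS]big_seq; apply: ler_sum => x /small xc.
  rewrite normrM mulrC (ger0_norm (sqr_ge0 x)) ler_wpM2r ?sqr_ge0//.
  have x0 : 0 < 1 + x * c by lra.
  rewrite normrM normfV (gtr0_norm x0) ler_pdivrMr//.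
  by have := normr_ge0 c; nra.
Qed.

End Growth.

(** * The complex exponential and the elementary factor of genus two *)

Section ComplexExp.
Variable R : realType.
Implicit Types (z w : R[i]).

Lemma expCD z w : expC (z + w) = expC z * expC w.
Proof.
case: z w => a b [c d]; rewrite /expC /= expRD cosD sinD.
by simpc; congr (_ +i* _); ring.
Qed.

Lemma expC0 : expC (0 : R[i]) = 1.
Proof. by rewrite /expC /= expR0 cos0 sin0 mul1r. Qed.

Lemma expC_sum (I : Type) (s : seq I) (F : I -> R[i]) :
  \prod_(i <- s) expC (F i) = expC (\sum_(i <- s) F i).
Proof.
elim: s => [|i s IH]; first by rewrite !big_nil expC0.
by rewrite !big_cons IH expCD.
Qed.

Lemma ctends_expC (T : Type) (F : set_system T) (FF : Filter F) (u : T -> R[i]) l :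
  ctends F u l -> ctends F (fun x => expC (u x)) (expC l).
Proof.
move=> [u1 u2]; apply: ctendsM.
  apply: ctends_real; apply: continuous_cvg u1; exact: continuous_expR.
split=> /=.
  by apply: continuous_cvg u2; exact: continuous_cos.
by apply: continuous_cvg u2; exact: continuous_sin.
Qed.

(** The Weierstrass elementary factor of genus two: it differs from 1 by a cubic term, so small
    roots with bounded sum of squares contribute little to a product. *)
Definition factor3 w := (1 - w) * expC (w + w ^+ 2 / 2).

Lemma factor3_0 : factor3 0 = 1.
Proof. by rewrite /factor3 subr0 expr0n mul0r addr0 expC0 mulr1. Qed.

Lemma factor3K w : factor3 w * expC (- (w + w ^+ 2 / 2)) = 1 - w.
Proof. by rewrite /factor3 -mulrA -expCD subrr expC0 mulr1. Qed.

Lemma ctends_factor3 (T : Type) (F : set_system T) (FF : Filter F) (u : T -> R[i]) l :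
  ctends F u l -> ctends F (fun x => factor3 (u x)) (factor3 l).
Proof.
move=> ul; apply: ctendsM.
  by apply: ctendsB => //; exact: ctends_cst.
apply: ctends_expC; apply: ctendsD => //; apply: ctendsM; last exact: ctends_cst.
by rewrite expr2; under eq_fun do rewrite expr2; exact: ctendsM.
Qed.

Lemma mean_value_bound (f df : R -> R) (K : R) :
  (forall x : R, is_derive x 1 f (df x)) -> (forall x, 0 <= x <= 1 -> `|df x| <= K) ->
  `|f 1 - f 0| <= K.
Proof.
move=> fd dfK; have fc : {within `[0, 1], continuous f}.
  by apply: derivable_within_continuous => x _; have [] := fd x.
have [c c01 ->] := MVT ltr01 (fun x _ => fd x) fc.
rewrite subr0 mulr1; apply: dfK.
by move: c01; rewrite in_itv /= => /andP[/ltW -> /ltW ->].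
Qed.

(* The derivative of s |-> factor3 (s w) is - s ^ 2 w ^ 3 expC (s w + (s w) ^ 2 / 2). *)
Lemma factor3_bound w (r : R) : normc w <= r ->
  normc (factor3 w - 1) <= 4 * expR (r + r ^+ 2) * normc w ^+ 3.
Proof.
case: w => a b wr; set w := _ +i* _ in wr *.
(* [X] and [Y] are the real and imaginary parts of s w + (s w)^2 / 2, [c3] and [d3] those of w^3,
   [f1] and [f2] those of [factor3] at s w. The real mean value theorem bounds the change of [f1]
   and of [f2] by [K] each, whence the constant 4. *)
pose X (s : R) := s * a + s ^+ 2 * ((a ^+ 2 - b ^+ 2) / 2).
pose Y (s : R) := s * b + s ^+ 2 * (a * b).
pose c3 := a ^+ 3 - 3 * a * b ^+ 2; pose d3 := 3 * a ^+ 2 * b - b ^+ 3.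
have w3 : w ^+ 3 = c3 +i* d3.
  by rewrite /w !exprS expr0 mulr1; simpc; congr (_ +i* _); rewrite /c3 /d3; ring.
pose f1 s := expR (X s) * ((1 - s * a) * cos (Y s) + s * b * sin (Y s)).
pose f2 s := expR (X s) * ((1 - s * a) * sin (Y s) - s * b * cos (Y s)).
have fE s : factor3 (s%:C * w) = f1 s +i* f2 s.
  have h : s%:C * w + (s%:C * w) ^+ 2 / 2 = X s +i* Y s.
    rewrite -(rmorph_nat (real_complex R)) -fmorphV /w expr2; simpc.
    by congr (_ +i* _); rewrite /X /Y; field.
  rewrite /factor3 h /expC /= /w; simpc.
  by congr (_ +i* _); rewrite /f1 /f2; ring.
have dX s : is_derive s (1 : R) X (a + s * (a ^+ 2 - b ^+ 2)).
  by apply: is_derive_eq; rewrite /GRing.scale /=; field.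
have dY s : is_derive s (1 : R) Y (b + 2 * s * (a * b)).
  by apply: is_derive_eq; rewrite /GRing.scale /=; field.
have df1 s : is_derive s (1 : R) f1
    (- s ^+ 2 * expR (X s) * (c3 * cos (Y s) + d3 * - sin (Y s))).
  by apply: is_derive_eq; rewrite /GRing.scale /= /c3 /d3; field.
have df2 s : is_derive s (1 : R) f2
    (- s ^+ 2 * expR (X s) * (c3 * sin (Y s) + d3 * cos (Y s))).
  by apply: is_derive_eq; rewrite /GRing.scale /= /c3 /d3; field.
have r0 : 0 <= r by rewrite (le_trans _ wr)// normc_ge0.
have c3w : `|c3| <= normc w ^+ 3.
  by have := Re_le_normc (w ^+ 3); rewrite normc_exp w3.
have d3w : `|d3| <= normc w ^+ 3.
  by have := Im_le_normc (w ^+ 3); rewrite normc_exp w3.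
have Xr s : 0 <= s <= 1 -> X s <= r + r ^+ 2.
  move=> /andP[s0 s1].
  have ar : `|a| <= r by rewrite (le_trans (Re_le_normc w)).
  have a2 : a ^+ 2 <= r ^+ 2 by rewrite -(real_normK (num_real a)) lerXn2r ?nnegrE.
  have ar' : a <= r by rewrite (le_trans (ler_norm a)).
  have s2 : 0 <= s ^+ 2 <= 1 by rewrite sqr_ge0 exprn_ile1.
  have /andP[s20 s21] := s2; have b2 := sqr_ge0 b; have r2 := sqr_ge0 r.
  apply: lerD; first by nra.
  apply: (@le_trans _ _ (s ^+ 2 * r ^+ 2)); last by rewrite ler_piMl.
  by rewrite ler_wpM2l//; lra.
pose K := expR (r + r ^+ 2) * (2 * normc w ^+ 3).
have w30 : 0 <= normc w ^+ 3 by rewrite exprn_ge0// normc_ge0.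
have bound s c d : 0 <= s <= 1 -> `|c| <= 1 -> `|d| <= 1 ->
    `|- s ^+ 2 * expR (X s) * (c3 * c + d3 * d)| <= K.
  move=> s01 c1 d1; have /andP[s0 s1] := s01.
  rewrite !normrM normrN ler_pM ?mulr_ge0//; last first.
    rewrite (le_trans (ler_normD _ _))// !normrM mulr2n mulrDl mul1r.
    by rewrite lerD//; [move: c3w c1|move: d3w d1]; move=> h1 h2;
      rewrite -[leRHS]mulr1 ler_pM.
  rewrite (ger0_norm (expR_ge0 _)) -[leRHS]mul1r ler_pM// ?expR_ge0//.
    by rewrite normrX exprn_ile1// ger0_norm.
  by rewrite ler_expR Xr.
have cos1 s : `|cos (Y s)| <= 1 by rewrite ler_norml cos_geN1 cos_le1.
have sin1 s : `|sin (Y s)| <= 1 by rewrite ler_norml sin_geN1 sin_le1.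
have h1 : `|f1 1 - f1 0| <= K.
  apply: mean_value_bound df1 _ => s s01.
  by apply: bound; rewrite ?normrN.
have h2 : `|f2 1 - f2 0| <= K.
  by apply: mean_value_bound df2 _ => s s01; apply: bound.
have -> : factor3 w - 1 = (f1 1 - f1 0) +i* (f2 1 - f2 0).
  have <- : factor3 (1%:C * w) - factor3 (0%:C * w) = (f1 1 - f1 0) +i* (f2 1 - f2 0).
    by rewrite !fE; simpc.
  by rewrite rmorph1 rmorph0 mul1r mul0r factor3_0.
rewrite (le_trans (normc_le_ReIm _))//= (le_trans (lerD h1 h2))//.
by rewrite (_ : K + K = 4 * expR (r + r ^+ 2) * normc w ^+ 3)// /K; ring.
Qed.

(** Induction on c P - 1 = (c - 1) P + (P - 1) together with 1 + d <= exp d; the bound on the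
    product itself is needed for the first summand. *)
Lemma prod_near1 (I : eqType) (s : seq I) (c : I -> R[i]) (d : I -> R) :
  (forall i, i \in s -> normc (c i - 1) <= d i) ->
  normc (\prod_(i <- s) c i) <= expR (\sum_(i <- s) d i) /\
  normc (\prod_(i <- s) c i - 1) <= expR (\sum_(i <- s) d i) - 1.
Proof.
elim: s => [|i s IH] cds.
  by rewrite !big_nil normc_1 expR0 !subrr normc_0.
have cd := cds i (mem_head _ _).
have [|IH1 IH2] := IH; first by move=> k ks; rewrite cds// inE ks orbT.
rewrite !big_cons expRD; set P := \prod_(j <- s) _ in IH1 IH2 *.
have d0 : 0 <= d i by rewrite (le_trans _ cd)// normc_ge0.
have di := expR_ge1Dx (d i).
have ci : normc (c i) <= 1 + d i.
  by rewrite (le_trans (normc_sub_le _ 1))// normc_1 lerD2l.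
have P0 := normc_ge0 P; have c0 := normc_ge0 (c i).
split; first by rewrite normcM ler_pM// (le_trans ci).
have -> : c i * P - 1 = (c i - 1) * P + (P - 1) by ring.
rewrite (le_trans (normc_triangle _ _))// normcM.
have := cd; have := normc_ge0 (c i - 1); nra.
Qed.

End ComplexExp.

(** Indices past the end read the default [x0], which contributes the neutral element; lists of
    varying length can thus be compared at a fixed [N]. *)
Lemma big_nth_take (T I : Type) (idx : T) (op : Monoid.law idx) (F : I -> T)
    (x0 : I) (s : seq I) N : F x0 = idx ->
  \big[op/idx]_(j < N) F (nth x0 s j) = \big[op/idx]_(x <- take N s) F x.
Proof.
move=> F0; elim: s N => [|x s IH] [|N]; rewrite ?big_ord0 ?big_nil//=.
  by rewrite big1// => j _; rewrite nth_nil.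
by rewrite big_ord_recl big_cons /=; congr (op _ _); rewrite -IH.
Qed.

(** * Limits of products over real reciprocal roots along an ultrafilter *)

Section LaguerrePolyaLimit.
Variables (R : realType) (U : set_system nat) (UU : UltraFilter U).
Variables (t : nat -> seq R) (W : R).
Hypothesis t_sorted : forall n, sorted (fun x y => `|y| <= `|x|) (t n).
Hypothesis t_sum : forall n, `|\sum_(x <- t n) x| <= W.
Hypothesis t_sqr : forall n, \sum_(x <- t n) x ^+ 2 <= W.
Local Notation toC := (real_complex R).

Let W0 : 0 <= W.
Proof. exact: le_trans (normr_ge0 _) (t_sum 0). Qed.

Let W1 : 0 <= 1 + W.
Proof. by rewrite addr_ge0. Qed.

Lemma nth_norm_decr n i j : (i <= j)%N -> `|(t n)`_j| <= `|(t n)`_i|.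
Proof.
move=> ij; have [js|sj] := ltnP j (size (t n)); last first.
  by rewrite (nth_default _ sj) normr0.
have tr : transitive (fun x y : R => `|y| <= `|x|).
  by move=> y x z /= yx zy; apply: le_trans yx.
apply: (sorted_leq_nth tr _ 0 (t_sorted n)) => //.
by rewrite inE (leq_ltn_trans ij).
Qed.

Lemma sum_nth_sqr_le n N : \sum_(j < N) (t n)`_j ^+ 2 <= \sum_(x <- t n) x ^+ 2.
Proof.
rewrite (@big_nth_take _ R _ _ (fun x : R => x ^+ 2)) ?expr0n//.
rewrite -{2}(cat_take_drop N (t n)) big_cat /= lerDl.
by apply: sumr_ge0 => x _; exact: sqr_ge0.
Qed.

(** By the sorting, the first [N.+1] squares are all at least that of index [N]. The roots therefore
    decay with the index at a rate independent of [n]. *)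
Lemma nth_sqr_le n N : (t n)`_N ^+ 2 * N.+1%:R <= W.
Proof.
rewrite (le_trans _ (t_sqr n))// (le_trans _ (sum_nth_sqr_le n N.+1))//.
rewrite (_ : _ * _ = \sum_(j < N.+1) (t n)`_N ^+ 2); last first.
  by rewrite sumr_const card_ord mulr_natr.
apply: ler_sum => j _.
rewrite -[leLHS](real_normK (num_real _)) -[leRHS](real_normK (num_real _)).
by rewrite lerXn2r ?nnegrE// nth_norm_decr// -ltnS.
Qed.

Lemma nth_norm_le n N : `|(t n)`_N| <= 1 + W.
Proof.
have := nth_sqr_le n N; have := sqr_ge0 (t n)`_N.
rewrite -(real_normK (num_real _)); have : 1 <= N.+1%:R :> R by rewrite ler1n.
by have := normr_ge0 (t n)`_N; have := W0; nra.
Qed.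

Lemma small_nth (eta : R) : 0 < eta -> exists N0, forall n N, (N0 <= N)%N ->
  `|(t n)`_N| <= eta.
Proof.
move=> eta0; have e2 : 0 < eta ^+ 2 by rewrite exprn_gt0.
exists (Num.truncn (W / eta ^+ 2)) => n N N0N.
have /truncn_itv/andP[_] : 0 <= W / eta ^+ 2 by rewrite divr_ge0// ltW.
rewrite ltr_pdivrMr// => hW; rewrite -(@ler_pXn2r _ 2)// ?nnegrE ?(ltW eta0)//.
rewrite real_normK ?num_real//.
have NN : (Num.truncn (W / eta ^+ 2)).+1%:R <= N.+1%:R :> R by rewrite ler_nat.
have N1 : 0 < N.+1%:R :> R by rewrite ltr0n.
rewrite -(ler_pM2r N1) (le_trans (nth_sqr_le n N))// ltW// (lt_le_trans hW)//.
by rewrite mulrC ler_pM2l.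
Qed.

Let cubic z := 4 * expR ((1 + W) * normc z + ((1 + W) * normc z) ^+ 2) * normc z ^+ 3.

Let cubic_ge0 z : 0 <= cubic z.
Proof. by rewrite !mulr_ge0 ?expR_ge0 ?exprn_ge0 ?normc_ge0. Qed.

Lemma factor3_cubic (x : R) z : `|x| <= 1 + W ->
  normc (factor3 (x%:C * z) - 1) <= cubic z * `|x| ^+ 3.
Proof.
move=> xW; have xz : normc (x%:C * z) <= (1 + W) * normc z.
  by rewrite normcM normc_real ler_wpM2r ?normc_ge0.
rewrite (le_trans (factor3_bound xz))// normcM normc_real /cubic !exprMn.
by rewrite (mulrC (`|x| ^+ 3)) mulrA.
Qed.

(** The first exponential bounds the product of the leading factors; the rest, multiplied by [eta],
    bounds the distance of the tail product from 1. *)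
Let rate z := expR (cubic z * ((1 + W) * W)) * (cubic z * W * expR (cubic z * W)).

Let rate_ge0 z : 0 <= rate z.
Proof.
exact: mulr_ge0 (expR_ge0 _) (mulr_ge0 (mulr_ge0 (cubic_ge0 z) W0) (expR_ge0 _)).
Qed.

Lemma sum_cube_le (s : seq R) (eta : R) : (forall x, x \in s -> `|x| <= eta) ->
  0 <= eta -> \sum_(x <- s) x ^+ 2 <= W -> \sum_(x <- s) `|x| ^+ 3 <= eta * W.
Proof.
move=> se eta0 sW; apply: (le_trans _ (ler_wpM2l eta0 sW)); rewrite mulr_sumr.
rewrite big_seq [leRHS]big_seq; apply: ler_sum => x xs.
by rewrite exprS real_normK ?num_real// ler_wpM2r ?sqr_ge0// se.
Qed.

Lemma factor3_prod_le (s : seq R) z : (forall x, x \in s -> `|x| <= 1 + W) ->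
  \sum_(x <- s) x ^+ 2 <= W ->
  normc (\prod_(x <- s) factor3 (x%:C * z)) <= expR (cubic z * ((1 + W) * W)).
Proof.
move=> sW s2; have := @prod_near1 R R s (fun x => factor3 (x%:C * z))
  (fun x => cubic z * `|x| ^+ 3).
move=> [x xs|h _]; first by rewrite factor3_cubic// sW.
rewrite (le_trans h)// ler_expR -mulr_sumr ler_wpM2l//.
exact: sum_cube_le.
Qed.

Lemma mem_norm_le n x : x \in t n -> `|x| <= 1 + W.
Proof. by move=> /(nthP 0)[i _ <-]; exact: nth_norm_le. Qed.

(** The tail product differs from 1 by at most exp u - 1 <= u exp u, where u is [cubic z] times the
    sum of the cubed moduli of the tail, itself at most [eta * W]. *)
Lemma factor3_truncation n N z (eta : R) : 0 <= eta <= 1 ->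
  (forall M, (N <= M)%N -> `|(t n)`_M| <= eta) ->
  normc (\prod_(x <- t n) factor3 (x%:C * z) -
         \prod_(j < N) factor3 (((t n)`_j)%:C * z)) <= eta * rate z.
Proof.
move=> /andP[eta0 eta1] tN.
rewrite (@big_nth_take _ R _ _ (fun x : R => factor3 (x%:C * z))); last first.
  by rewrite rmorph0 mul0r factor3_0.
rewrite -{1}(cat_take_drop N (t n)) big_cat /= -[X in _ * _ - X]mulr1 -mulrBr normcM.
have sub2 : \sum_(x <- take N (t n)) x ^+ 2 <= W /\ \sum_(x <- drop N (t n)) x ^+ 2 <= W.
  have := t_sqr n; rewrite -{1}(cat_take_drop N (t n)) big_cat /=.
  have h (s : seq R) : 0 <= \sum_(x <- s) x ^+ 2.
    by apply: sumr_ge0 => x _; exact: sqr_ge0.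
  by have := h (take N (t n)); have := h (drop N (t n)); split; lra.
rewrite /rate mulrCA ler_pM ?normc_ge0//.
  apply: factor3_prod_le => [x /mem_take|]; [exact: mem_norm_le|exact: sub2.1].
have dropE x : x \in drop N (t n) -> `|x| <= eta.
  by move=> /(nthP 0)[i _ <-]; rewrite nth_drop tN// leq_addr.
have := @prod_near1 R R (drop N (t n)) (fun x => factor3 (x%:C * z))
  (fun x => cubic z * `|x| ^+ 3).
move=> [x /mem_drop xs|_ h]; first by rewrite factor3_cubic// (mem_norm_le xs).
rewrite (le_trans h)// -mulr_sumr.
have h3 := sum_cube_le dropE eta0 sub2.2.
have h4 : 0 <= \sum_(x <- drop N (t n)) `|x| ^+ 3.
  by apply: sumr_ge0 => x _; rewrite exprn_ge0.
set S := \sum_(x <- _) _ in h3 h4 *.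
have D0 := cubic_ge0 z; set D := cubic z in D0 *.
have hx (x : R) : expR x - 1 <= x * expR x.
  have := expR_ge1Dx (- x); rewrite -(ler_pM2r (expR_gt0 x)) -expRD addNr expR0.
  by rewrite mulrDl mul1r mulNr; lra.
rewrite (le_trans (hx _))//.
have DS : D * S <= eta * (D * W) by rewrite mulrCA ler_wpM2l.
have DW : 0 <= D * W by rewrite mulr_ge0.
have DS0 : 0 <= D * S by exact: mulr_ge0.
rewrite [leRHS]mulrA ler_pM ?expR_ge0//.
by rewrite ler_expR (le_trans DS)// ler_piMl.
Qed.

Section LimitRoots.
Variable y : nat -> R.
Hypothesis y_lim : forall j, (fun n => (t n)`_j) @ U --> y j.

Lemma limit_root_decr i j : (i <= j)%N -> `|y j| <= `|y i|.
Proof.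
move=> ij; have norm_lim k : (fun n => `|(t n)`_k|) @ U --> `|y k| by exact: cvg_norm.
apply: (@ler_cvg_to nat U _ R _ _ _ _ (norm_lim j) (norm_lim i)).
by apply: nearW => n; exact: nth_norm_decr.
Qed.

(** Only an inequality survives in the limit: many small roots may carry mass that no fixed index
    retains. *)
Lemma limit_root_sqr_le N (a : R) :
  (fun n => \sum_(x <- t n) x ^+ 2) @ U --> a -> \sum_(j < N) y j ^+ 2 <= a.
Proof.
move=> ta.
have tN : (fun n => \sum_(j < N) (t n)`_j ^+ 2) @ U --> \sum_(j < N) y j ^+ 2.
  elim: N => [|N IH].
    by rewrite big_ord0; under eq_fun do rewrite big_ord0; exact: cvg_cst.
  rewrite big_ord_recr; under eq_fun do rewrite big_ord_recr.
  by apply: cvgD => //; rewrite expr2; under eq_fun do rewrite expr2; exact: cvgM.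
by apply: (@ler_cvg_to nat U _ R _ _ _ _ tN ta); apply: nearW => n; exact: sum_nth_sqr_le.
Qed.

(** The truncation error is uniform in [n], so the limit along [U] can be taken at fixed [N] before
    [N] grows. *)
Lemma factor3_prod_limit z L :
  ctends U (fun n => \prod_(x <- t n) factor3 (x%:C * z)) L ->
  ctends \oo (fun N => \prod_(j < N) factor3 ((y j)%:C * z)) L.
Proof.
move=> tL; apply/ctends_normcP => e e0.
have r1 : 0 < rate z + 1 by rewrite ltr_wpDl.
pose eta := Num.min 1 (e / (rate z + 1)).
have eta0 : 0 < eta by rewrite lt_min ltr01 divr_gt0.
have eta1 : 0 <= eta <= 1 by rewrite ltW//= ge_min lexx.
have [N0 N0P] := small_nth eta0; exists N0 => // N /= N0N.
have lim : ctends U (fun n => \prod_(x <- t n) factor3 (x%:C * z) -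
    \prod_(j < N) factor3 (((t n)`_j)%:C * z)) (L - \prod_(j < N) factor3 ((y j)%:C * z)).
  apply: ctendsB => //; apply: ctends_prod => j; apply: ctends_factor3.
  by apply: ctendsM; [exact: ctends_real|exact: ctends_cst].
apply: (@le_lt_trans _ _ (eta * rate z)).
  apply: (ctends_normc_le _ lim); apply: nearW => n.
  by apply: factor3_truncation => // M NM; rewrite N0P// (leq_trans N0N).
have : eta <= e / (rate z + 1) by rewrite ge_min lexx orbT.
rewrite ler_pdivlMr//; have := rate_ge0 z; nra.
Qed.

(* Vanishing limits y j contribute no factor; they occur only at the end. *)
Lemma limit_roots_canonical_product (G : R[i] -> R[i]) : cvgn (series (fun j => y j ^+ 2)) ->
  (forall z, ctends \oo
    (fun N => \prod_(j < N) ((1 - (y j)%:C * z) * expC ((y j)%:C * z))) (G z)) ->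
  canonical_product G.
Proof.
move=> y2 yG.
have factorE (x : R) z : weierstrass_factor x^-1 z = (1 - x%:C * z) * expC (x%:C * z).
  by rewrite /weierstrass_factor -fmorphV invrK (mulrC z).
have [y_neq0|] := pselect (forall j, y j != 0).
  right; exists (fun j => (y j)^-1); split => [j||z].
  - by rewrite invr_eq0.
  - rewrite (_ : (fun j => _) = fun j => y j ^+ 2)//.
    by apply/funext => j; rewrite exprVn invrK.
  by apply/ctends_cvgP; under eq_fun do under eq_bigr do rewrite factorE.
move=> /existsNP[j0 /negP/negPn j0y].
have ex0 : exists j, y j == 0 by exists j0.
have [N yN Nmin] := ex_minnP ex0; left.
exists [seq (y j)^-1 | j <- iota 0 N]; split.
  move=> _ /mapP[j jN ->]; rewrite invr_eq0; apply/negP => /Nmin Nj.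
  by move: jN; rewrite mem_iota add0n /= ltnNge Nj.
move=> z; apply: (ctends_unique _ (yG z)).
rewrite big_map; under eq_bigr do rewrite factorE.
have -> : \prod_(j <- iota 0 N) ((1 - (y j)%:C * z) * expC ((y j)%:C * z)) =
    \prod_(j < N) ((1 - (y j)%:C * z) * expC ((y j)%:C * z)).
  by rewrite -(big_mkord xpredT (fun j => (1 - (y j)%:C * z) * expC ((y j)%:C * z)))
    /index_iota subn0.
apply/ctends_normcP => e e0; exists N => // M /= NM.
rewrite -(big_mkord xpredT (fun j => (1 - (y j)%:C * z) * expC ((y j)%:C * z))).
rewrite -[X in _ - X](big_mkord xpredT (fun j => (1 - (y j)%:C * z) * expC ((y j)%:C * z))).
rewrite (@big_cat_nat _ _ _ N 0 M)//= [X in _ * X]big1_seq ?mulr1 ?subrr ?normc_0//.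
move=> j; rewrite mem_index_iota => /andP[_ /andP[Nj _]].
have -> : y j = 0.
  by apply/eqP; rewrite -normr_le0 (le_trans (limit_root_decr Nj))// (eqP yN) normr0.
by rewrite rmorph0 mul0r subr0 expC0 mulr1.
Qed.

End LimitRoots.

Lemma recip_prod_factor3 (s : seq R) z : (recip_prod (map toC s)).[z] =
  (\prod_(x <- s) factor3 (x%:C * z)) *
  expC (- ((\sum_(x <- s) x)%:C * z + (\sum_(x <- s) x ^+ 2)%:C * (z ^+ 2 / 2))).
Proof.
rewrite horner_recip_prod big_map !rmorph_sum /= !mulr_suml -big_split /= -sumrN.
rewrite -expC_sum -big_split /=; apply: eq_bigr => x _.
by rewrite -(factor3K (x%:C * z)) exprMn -[in LHS](mulrA (x%:C ^+ 2)) rmorphXn.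
Qed.

Lemma recip_prod_limit_sorted : exists G : R[i] -> R[i], laguerre_polya G /\
  forall z, ctends U (fun n => (recip_prod (map toC (t n))).[z]) (G z).
Proof.
have /choice[y y_lim] : forall j, exists l : R, (fun n => (t n)`_j) @ U --> l.
  by move=> j; apply: ultra_cvg_bounded => n; exact: nth_norm_le.
have /choice[L L_lim] : forall z, exists l,
    ctends U (fun n => \prod_(x <- t n) factor3 (x%:C * z)) l.
  move=> z; apply: ultra_ctends_bounded => n.
  by apply: factor3_prod_le => // x; exact: mem_norm_le.
have [b b_lim] := ultra_cvg_bounded UU t_sum.
have [a a_lim] : exists a : R, (fun n => \sum_(x <- t n) x ^+ 2) @ U --> a.
  apply: (ultra_cvg_bounded UU (B := W)) => n.
  by rewrite ger0_norm// sumr_ge0// => x _; exact: sqr_ge0.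
have y2a N : series (fun j => y j ^+ 2) N <= a.
  by rewrite /series /= big_mkord; exact: limit_root_sqr_le.
have y2_cvg : cvgn (series (fun j => y j ^+ 2)).
  apply: nondecreasing_is_cvgn.
    by apply: nondecreasing_series => j _ _; exact: sqr_ge0.
  by exists a => _ [N _ <-].
set sigma := limn (series (fun j => y j ^+ 2)) in y2_cvg.
have sigma_a : sigma <= a by apply: limr_le => //; exact: nearW.
(* [L] is the limit of the genus-two products. Removing the quadratic exponent belonging to [sigma]
   gives the genus-one product over the [y j]; the surplus [a - sigma] of the squares, nonnegative
   by [limit_root_sqr_le], gives the Gaussian, and [- b] the linear exponent. *)
pose Gc z := L z * expC (- (sigma%:C * (z ^+ 2 / 2))).
pose G z := expC (- ((a - sigma) / 2)%:C * z ^+ 2 + (- b)%:C * z) * Gc z.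
have G_lim z : ctends U (fun n => (recip_prod (map toC (t n))).[z]) (G z).
  have -> : G z = L z * expC (- (b%:C * z + a%:C * (z ^+ 2 / 2))).
    rewrite /G /Gc mulrCA -expCD; congr (_ * expC _).
    rewrite rmorphM rmorphB fmorphV !rmorphN /= rmorph_nat.
    by field.
  under eq_fun do rewrite recip_prod_factor3.
  apply: ctendsM => //; apply: ctends_expC.
  rewrite -mulN1r; under eq_fun do rewrite -mulN1r.
  apply: ctendsM; first exact: ctends_cst.
  by apply: ctendsD; (apply: ctendsM; [exact: ctends_real|exact: ctends_cst]).
exists G; split => //; split.
  apply: (entire_ultra_limit UU _ G_lim) => r r0.
  by exists (expR (r * W + r ^+ 2 * W)) => n z zr; exact: normc_recip_prod_le.
exists 1, ((a - sigma) / 2), (- b), 0%N, Gc; split.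
- by rewrite divr_ge0// subr_ge0.
- apply: (limit_roots_canonical_product y_lim y2_cvg) => z.
  have factorE N : \prod_(j < N) ((1 - (y j)%:C * z) * expC ((y j)%:C * z)) =
      (\prod_(j < N) factor3 ((y j)%:C * z)) *
      expC (-1 * ((series (fun j => y j ^+ 2) N)%:C * (z ^+ 2 / 2))).
    rewrite /series /= big_mkord rmorph_sum /= mulr_suml mulr_sumr -expC_sum -big_split /=.
    apply: eq_bigr => j _; rewrite /factor3 -mulrA -expCD; congr (_ * expC _).
    by rewrite exprMn rmorphXn mulN1r -mulrA addrK.
  under eq_fun do rewrite factorE.
  apply: ctendsM; first exact: factor3_prod_limit (L_lim z).
  apply: ctends_expC; rewrite -[- (_ * _)]mulN1r.
  apply: ctendsM; first exact: ctends_cst.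
  apply: ctendsM; last exact: ctends_cst.
  exact: ctends_real.
- by move=> z; rewrite rmorph1 expr0 !mul1r.
Qed.

End LaguerrePolyaLimit.

(** * Bounds for the whole sequence, and a real point where the limit is nonzero *)

Section RealEntireLimits.
Variable R : realType.
Local Notation toC := (real_complex R).
Implicit Types (p : nat -> {poly R[i]}) (P : nat -> {poly R}).

Lemma recip_prod_limit (U : set_system nat) (UU : UltraFilter U)
    (t : nat -> seq R) (W : R) :
  (forall n, `|\sum_(x <- t n) x| <= W) ->
  (forall n, \sum_(x <- t n) x ^+ 2 <= W) ->
  exists G : R[i] -> R[i], laguerre_polya G /\
    forall z, ctends U (fun n => (recip_prod (map toC (t n))).[z]) (G z).
Proof.
move=> t1 t2; pose le (x y : R) := `|y| <= `|x|.
have pt n : perm_eq (sort le (t n)) (t n) by rewrite perm_sort.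
have tot : total le by move=> x y; exact: le_total.
have [||n|G [GL Glim]] := @recip_prod_limit_sorted R U UU (fun n => sort le (t n)) W.
- by move=> n; exact: sort_sorted.
- by move=> n; rewrite (perm_big _ (pt n)).
- by rewrite (perm_big _ (pt n)).
exists G; split=> // z; have := Glim z.
rewrite (_ : (fun n => _) = fun n => (recip_prod (map toC (t n))).[z])//.
apply/funext => n; congr (_.[z]).
by rewrite /recip_prod !big_map (perm_big _ (pt n)).
Qed.

Lemma ctends_eventually (u v : nat -> R[i]) l N :
  (forall n, (N <= n)%N -> u n = v n) -> ctends \oo u l -> ctends \oo v l.
Proof.
move=> uv /ctends_normcP ul; apply/ctends_normcP => e /ul ue.
have : \forall n \near \oo, (N <= n)%N by exists N.
by apply: filterS2 ue => n un Nn; rewrite -uv.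
Qed.

Lemma ctends_bounded (u : nat -> R[i]) l : ctends \oo u l ->
  exists B : R, forall n, normc (u n) <= B.
Proof.
move=> /ctends_normcP /(_ 1 ltr01) [N _ uN].
have s0 : 0 <= \sum_(n < N) normc (u n) by apply: sumr_ge0 => n _; exact: normc_ge0.
exists (normc l + 1 + \sum_(n < N) normc (u n)) => n; have [nN|Nn] := ltnP n N.
  rewrite (bigD1 (Ordinal nN))//= addrCA lerDl addr_ge0 ?addr_ge0 ?normc_ge0//.
  by apply: sumr_ge0 => k _; exact: normc_ge0.
rewrite ler_wpDr// (le_trans (normc_sub_le _ l))// lerD2l normc_subC ltW//.
exact: uN.
Qed.

Lemma ctends_away (u : nat -> R[i]) l : ctends \oo u l -> l != 0 ->
  exists N, forall n, (N <= n)%N -> normc l / 2 <= normc (u n).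
Proof.
rewrite -normc_gt0 => /ctends_normcP ul l0.
have [|N _ uN] := ul (normc l / 2); first by rewrite divr_gt0.
exists N => n /uN; have := normc_sub_le l (u n); lra.
Qed.

(** The finitely many skipped polynomials have finitely many coefficients. Replacing [n] by
    [maxn n N] discards them while keeping a sequence indexed by all of [nat]. *)
Lemma coef_bounded_eventually p N :
  coef_bounded (fun n => p (maxn n N)) -> coef_bounded p.
Proof.
move=> pC r r0; have [B pB] := pC r r0.
pose S n := \sum_(k < size (p n)) normc (p n)`_k * r ^+ k.
have S0 n : 0 <= S n.
  by apply: sumr_ge0 => k _; rewrite mulr_ge0 ?normc_ge0 ?exprn_ge0.
have B0 : 0 <= B.
  by rewrite (le_trans _ (pB 0%N 0%N))// mulr_ge0 ?normc_ge0 ?exprn_ge0.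
exists (B + \sum_(n < N) S n) => n k; have [nN|Nn] := ltnP n N; last first.
  by rewrite ler_wpDr ?sumr_ge0//; have := pB n k; rewrite (maxn_idPl Nn).
rewrite ler_wpDl// (bigD1 (Ordinal nN))//= ler_wpDr ?sumr_ge0//.
have [kp|pk] := ltnP k (size (p n)); last first.
  by rewrite nth_default// normc_0 mul0r.
rewrite /S (bigD1 (Ordinal kp))//= lerDl sumr_ge0// => j _.
by rewrite mulr_ge0 ?normc_ge0 ?exprn_ge0.
Qed.

Lemma coef_bounded_antiderivn p m :
  (forall k, exists C : R, forall n, normc (p n)`_k <= C) ->
  coef_bounded (fun n => (p n)^`(m)) -> coef_bounded p.
Proof.
move=> pC; elim: m => [|m IH]; first by under eq_fun do rewrite derivn0.
move=> h; apply: IH; have [C CP] := pC m.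
apply: (coef_bounded_antideriv (C := C *+ m ^_ m)) => [n|].
  rewrite coef_derivn addn0 -mulr_natl normcM normc_nat mulr_natl.
  by rewrite lerMn2r CP orbT.
by under eq_fun do rewrite -derivnS.
Qed.

Lemma bounded_form_coef_bounded M (W : R) P :
  (forall n, bounded_form M W (P n)) -> coef_bounded (fun n => map_poly toC (P n)).
Proof.
move=> PW; apply: disc_bounded_coef => r r0.
exists (W * (1 + r) ^+ M *+ M.+1 * expR (r * W + r ^+ 2 * W)) => n z zr.
exact: bounded_form_growth.
Qed.

(** The constant coefficient of the m-th derivative is m! times the coefficient of index [m], hence
    eventually away from 0 even if [f 0] vanishes; m antiderivatives lead back to [P]. *)
Lemma few_nonreal_roots_coef_bounded M P (f : nat -> R[i]) m :
  (forall n, few_nonreal_roots M (P n)) ->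
  (forall k, ctends \oo (fun n => (map_poly toC (P n))`_k) (f k)) ->
  f m != 0 -> coef_bounded (fun n => map_poly toC (P n)).
Proof.
move=> PM Pf fm0.
have /choice[B PB] : forall k, exists B : R, forall n, normc (map_poly toC (P n))`_k <= B.
  by move=> k; exact: ctends_bounded (Pf k).
have [N PN] := ctends_away (Pf m) fm0.
have B0 k : 0 <= B k by rewrite (le_trans _ (PB k 0%N))// normc_ge0.
have c0 : 0 < normc (f m) / 2 by rewrite divr_gt0// normc_gt0.
have B'0 k : 0 <= B (m + k)%N *+ (m + k) ^_ m by rewrite mulrn_wge0.
have [W W0 PW] := a_priori_form M B'0 c0.
apply: (@coef_bounded_eventually _ N); apply: (@coef_bounded_antiderivn _ m).
  by move=> k; exists (B k) => n; exact: PB.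
have -> : (fun n => (map_poly toC (P (maxn n N)))^`(m)) =
    fun n => map_poly toC (P (maxn n N))^`(m).
  by apply/funext => n; rewrite derivn_map.
apply: (@bounded_form_coef_bounded M W) => n; apply: PW.
- exact: few_nonreal_roots_derivn.
- move=> k; rewrite coef_derivn normrMn lerMn2r.
  by have := PB (m + k)%N (maxn n N); rewrite coef_map normc_real => ->; rewrite orbT.
- have := PN _ (leq_maxr n N); rewrite coef_map normc_real => /le_trans; apply.
  by rewrite coef_derivn addn0 normrMn ffactnn -mulr_natl ler_peMl// ler1n fact_gt0.
Qed.

(** If the sum vanished on the real line, its first nonzero term would equal minus the tail, forcing
    [normc (f m) <= 2 * B * x] for all small positive [x]. *)
Lemma power_series_real_neq0 p (f : nat -> R[i]) : coef_bounded p ->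
  (forall k, ctends \oo (fun n => (p n)`_k) (f k)) ->
  (exists k, f k != 0) -> exists x : R, power_series_sum f x%:C != 0.
Proof.
move=> pC pf ex_f; have [m fm0 fmin] := ex_minnP ex_f.
have [//|B fB] := limit_coef_bounded pC pf (r := 2).
apply: contrapT => /forallNP F0.
have B0 : 0 <= B by rewrite (le_trans _ (fB 0%N))// mulr_ge0 ?normc_ge0.
have fx (x : R) : 0 < x -> x <= 1 -> normc (f m) <= 2 * B * x.
  move=> x0 x1.
  have Fx : power_series_sum f x%:C = 0 by apply/eqP/negPn/negP; exact: F0.
  have lim := power_series_ctends pC pf x%:C; rewrite Fx in lim.
  have nx : normc x%:C = x by rewrite normc_real gtr0_norm.
  have : normc (0 + - (f m * x%:C ^+ m)) <= 2 * B * x ^+ m.+1.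
    apply: (ctends_normc_le _ (ctendsD _ lim (ctends_cst _ _))).
    exists m.+1 => // n /= mn; rewrite /power_series /series /=.
    rewrite (@big_cat_nat _ _ _ m.+1)//= big_nat_recr//= big1_seq ?add0r; last first.
      move=> k; rewrite mem_index_iota => /andP[_ /andP[_ km]].
      have [->|/fmin] := eqVneq (f k) 0; first by rewrite mul0r.
      by rewrite leqNgt km.
    rewrite addrAC subrr add0r -{1}(add0n m.+1) big_addn.
    rewrite (_ : \sum_(0 <= i < n - m.+1) _ =
      (\sum_(0 <= i < n - m.+1) f (i + m.+1)%N * x%:C ^+ i) * x%:C ^+ m.+1); last first.
      by rewrite mulr_suml; apply: eq_bigr => i _; rewrite exprD mulrA.
    rewrite normcM normc_exp nx ler_wpM2r ?exprn_ge0 ?(ltW x0)//.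
    have := @power_sum_tail R (fun k => f (k + m.+1)%N) B 1 x%:C 0 (n - m.+1) ler01.
    rewrite expr0 !mulr1; apply; last by rewrite nx.
    move=> k; rewrite (le_trans _ (fB (k + m.+1)%N))// ler_wpM2l ?normc_ge0//.
    by rewrite ler_weXn2l ?leq_addr// ler1n.
  rewrite add0r normc_opp normcM normc_exp nx exprS mulrA ler_pM2r//.
  by rewrite exprn_gt0.
have fm : 0 < normc (f m) by rewrite normc_gt0.
(* For this [x], [(4 * B + 1) * x <= normc (f m) <= 2 * B * x], which is absurd. *)
pose x := Num.min 1 (normc (f m) / (4 * B + 1)).
have B1 : 0 < 4 * B + 1 by rewrite ltr_wpDl// mulr_ge0.
have x0 : 0 < x by rewrite lt_min ltr01 divr_gt0.
have x1 : x <= 1 by rewrite ge_min lexx.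
have : x <= normc (f m) / (4 * B + 1) by rewrite ge_min lexx orbT.
rewrite ler_pdivlMr//; have := fx x x0 x1; nra.
Qed.

End RealEntireLimits.

(** The first factors have at most [M.+1] coefficients, all bounded, so they converge along [U] to a
    polynomial; [recip_prod_limit] treats the second factors. *)
Lemma bounded_form_limit (R : realType) (U : set_system nat) (UU : UltraFilter U)
    M (W : R) (P : nat -> {poly R}) : (forall n, bounded_form M W (P n)) ->
  exists (q : {poly R}) (G : R[i] -> R[i]), laguerre_polya G /\
    forall z, ctends U (fun n => (map_poly (real_complex R) (P n)).[z])
      ((map_poly (real_complex R) q).[z] * G z).
Proof.
move=> PW; have /choice[Q PQ] := PW; have /choice[t {PQ}Pt] := PQ.
have [|n|G [GL Glim]] := @recip_prod_limit R U UU t W; try by case: (Pt n).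
  by move=> n; case: (Pt n).
have /choice[l Ql] : forall k, exists l : R, (fun n => (Q n)`_k) @ U --> l.
  by move=> k; apply: (ultra_cvg_bounded UU (B := W)) => n; case: (Pt n).
exists (\poly_(k < M.+1) l k), G; split => // z.
have -> : (fun n => (map_poly (real_complex R) (P n)).[z]) =
    fun n => (map_poly (real_complex R) (Q n)).[z] *
             (recip_prod (map (real_complex R) (t n))).[z].
  by apply/funext => n; have [-> _ _ _ _] := Pt n; rewrite rmorphM hornerM /= map_recip_prod.
apply: ctendsM => //.
rewrite (@horner_coef_wide _ M.+1); last by rewrite size_map_poly size_poly.
have -> : (fun n => (map_poly (real_complex R) (Q n)).[z]) =
    fun n => \sum_(k < M.+1) ((Q n)`_k)%:C * z ^+ k.
  apply/funext => n; rewrite (@horner_coef_wide _ M.+1).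
    by apply: eq_bigr => k _; rewrite coef_map.
  by rewrite size_map_poly; case: (Pt n).
apply: ctends_sum => k; rewrite coef_map coef_poly ltn_ord.
by apply: ctendsM; [exact: ctends_real|exact: ctends_cst].
Qed.

(** The limit may vanish at 0, so the a priori bounds are applied to the polynomials recentred at
    [x], whose constant coefficients stay away from 0; [bounded_form_shift] returns to the centre
    0. *)
Lemma bounded_form_near (R : realType) M (P : nat -> {poly R}) (x l : R) :
  (forall n, few_nonreal_roots M (P n)) ->
  coef_bounded (fun n => map_poly (real_complex R) (P n)) ->
  ctends \oo (fun n => (map_poly (real_complex R) (P n)).[x%:C]) l%:C -> l != 0 ->
  exists M' W' N, forall n, bounded_form M' W' (P (maxn n N)).
Proof.
move=> PM PC Pl l0; pose q n := P n \Po ('X + x%:P).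
have qE n : map_poly (real_complex R) (q n) =
    map_poly (real_complex R) (P n) \Po ('X + x%:C%:P).
  by rewrite map_comp_poly /= rmorphD /= map_polyX map_polyC.
have qC := disc_bounded_coef (disc_bounded_shift x%:C (coef_bounded_disc PC)).
have [//|B qB] := qC 1.
have B0 : 0 <= B by rewrite (le_trans _ (qB 0%N 0%N))// mulr_ge0 ?normc_ge0 ?exprn_ge0.
have lC0 : l%:C != 0 by rewrite -normc_gt0 normc_real normr_gt0.
have [N PN] := ctends_away Pl lC0.
have c0 : 0 < normc l%:C / 2 by rewrite divr_gt0// normc_gt0.
have [W W0 PW] := @a_priori_form R M (fun=> B) _ (fun=> B0) c0.
have [M' [W' MW]] := bounded_form_shift M x W0.
exists M', W', N => n; apply: MW; apply: PW.
- exact: few_nonreal_roots_shift.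
- by move=> k; have := qB (maxn n N) k; rewrite expr1n mulr1 -qE coef_map normc_real.
- rewrite -horner_coef0 /q horner_comp !hornerE -(normc_real (P _).[x]).
  by rewrite -(horner_map (real_complex R)); exact: PN (leq_maxr n N).
Qed.

Theorem theorem1p2 (R : realType) (p : nat -> {poly R[i]}) (f : nat -> R[i])
    (p_real : forall n : nat, real_poly (p n))
    (p_weak : weakly_converges p f)
    (f_neq0 : exists k : nat, f k != 0)
    (p_bounded : exists M : nat,
        forall n : nat, (num_zeros (p n) (~` real_line R) <= M)%N) :
  radius_of_convergence f = +oo%E /\
  laguerre_polya_star (power_series_sum f) /\
  strongly_converges (fun n => horner (p n)) (power_series_sum f).
Proof.
have /choice[P pE] : forall n, exists P, p n = map_poly (real_complex R) P.
  by move=> n; exact: real_poly_map.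
have [M pM] := p_bounded.
have PM n : few_nonreal_roots M (P n).
  by apply: few_nonreal_roots_num_zeros; rewrite -pE.
have p_coef k : ctends \oo (fun n => (p n)`_k) (f k).
  have [/ctends_cvgP pk ->] := p_weak k.
  have -> : (fun n => (p n)`_k) = fun n => (k`!%:R)^-1 * (p n)^`(k).[0].
    apply/funext => n; rewrite horner_coef0 coef_derivn addn0 ffactnn -(mulr_natl (p n)`_k).
    by rewrite mulKf// pnatr_eq0 -lt0n fact_gt0.
  by apply: ctendsM => //; exact: ctends_cst.
have pP : p = fun n => map_poly (real_complex R) (P n) by apply/funext.
have [m fm0] := f_neq0.
have pC : coef_bounded p.
  by rewrite pP; apply: (few_nonreal_roots_coef_bounded PM _ fm0) => k; have := p_coef k; rewrite pP.
have p_lim := horner_ctends pC p_coef.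
set F := power_series_sum f in p_lim *.
have F_real x : complex.Im (F x%:C) = 0.
  have [_] := p_lim x%:C.
  rewrite (_ : (fun n => _) = fun=> 0); last first.
    by apply/funext => n; rewrite pE horner_map.
  by move=> h; rewrite -(cvg_unique _ h (cvg_cst _)).
have [x Fx0] : exists x : R, F x%:C != 0.
  exact: power_series_real_neq0 pC p_coef f_neq0.
have FxE : F x%:C = (complex.Re (F x%:C))%:C.
  by have := F_real x; case: (F x%:C) => a b /= ->.
have [|||M' [W' [N PW]]] := @bounded_form_near R M P x (complex.Re (F x%:C)) PM.
- by rewrite -pP.
- by rewrite -FxE; have := p_lim x%:C; rewrite pP.
- by apply: contraNneq Fx0 => h; rewrite FxE h.
(* Refining [\oo] to an ultrafilter keeps the limit [F] of the polynomials and makes the two factors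
   converge separately; uniqueness of limits then gives the factorization of [F]. *)
have [U [UU ooU]] := @ultraFilterLemma nat \oo _.
have [q [G [GL PG]]] := bounded_form_limit UU PW.
split; first exact: radius_of_convergence_infinite pC p_coef.
split; last exact: strongly_converges_discs pC p_coef.
split.
- apply: (entire_ultra_limit UU (coef_bounded_disc pC)) => z.
  exact: ctends_sub ooU (p_lim z).
- by move=> _ [_ [y _ <-] <-]; apply/real_lineE; exact: F_real.
- exists (map_poly (real_complex R) q), G; split => //.
    move=> _ [_ [y _ <-] <-]; by rewrite horner_map; exists q.[y].
  move=> z; apply: (ctends_unique _ _ (PG z)).
  apply: (ctends_sub ooU); apply: (ctends_eventually (N := N) _ (p_lim z)) => n Nn.
  by rewrite (maxn_idPl Nn) pE.
Qed.
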